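(* A sequence $(\mathbf t_k)_{k\in\mathbb N}$ of binary trees with the number of leaves of $\mathbf t_k$ going to infinity as $k\to\infty$ converges in the Doob--Martin compactification of the Rémy chain if and only if for each $m\in\mathbb N$ the sequence of random binary trees $(S_m^{\mathbf t_k})_{k}$ (defined for all sufficiently large $k$) converges in distribution. Moreover, two such convergent sequences of binary trees $(\mathbf t_k')_{k\in\mathbb N}$ and $(\mathbf t_k'')_{k\in\mathbb N}$ converge to the same point in the Doob--Martin boundary if and only if for all $m\in\mathbb N$ the limiting distribution of $S_m^{\mathbf t_k'}$ as $k\to\infty$ coincides with the limiting distribution of $S_m^{\mathbf t_k''}$ as $k\to\infty$.
   Context: $\mathbb N=\{1,2,\dots\}$. A binary tree is a finite rooted planar tree in which every vertex has zero or two children, left and right children being distinguished; it has $n+1$ leaves and $2n+1$ vertices for some $n$. $\aleph$ is the unique binary tree with 3 vertices. Rémy chain $(T_n)_{n\in\mathbb N}$: the Markov chain with $T_1=\aleph$ in which $T_{n+1}$ is obtained from $T_n$ by picking a vertex $v$ of $T_n$ uniformly at random, cutting off the subtree rooted at $v$, attaching a copy of $\aleph$ at the place where $v$ was, and re-attaching the cut-off subtree to one of the two leaves of the copy of $\aleph$, chosen uniformly at random. So $T_n$ has $2n+1$ vertices. Doob--Martin compactification: let $E$ be the set of binary trees with at least 3 vertices, $p(\mathbf s,\mathbf t)$ the probability that the chain started at $\mathbf s$ ever hits $\mathbf t$, and $K(\mathbf s,\mathbf t)=p(\mathbf s,\mathbf t)/p(\aleph,\mathbf t)$. The map $\mathbf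 t\mapsto K(\cdot,\mathbf t)$ identifies $E$ with a subset of $\mathbb R_+^E$ (product topology); the closure $\bar E$ of this set is the Doob--Martin compactification, and $\bar E\setminus E$ is the Doob--Martin boundary. Thus $(\mathbf t_k)$ converges in $\bar E$ iff $(K(\mathbf s,\mathbf t_k))_k$ converges in $\mathbb R$ for every $\mathbf s\in E$. Sampled subtrees: for $m\in\mathbb N$ and a binary tree $\mathbf t$ with more than $m+1$ leaves, $S_m^{\mathbf t}$ is the random binary tree with $m+1$ leaves spanned by $m+1$ leaves of $\mathbf t$ picked uniformly at random without replacement (its vertices are the chosen leaves and their most recent common ancestors in $\mathbf t$; a vertex is below and to the left (resp. right) of another in $S_m^{\mathbf t}$ iff it is so in $\mathbf t$). *)

(* Defs.v *)
From HB Require Import structures.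
From mathcomp Require Import all_boot all_order all_algebra.
From mathcomp Require Import all_classical all_reals all_analysis.

Set Implicit Arguments.
Unset Strict Implicit.
Unset Printing Implicit Defensive.
Import Order.TTheory GRing.Theory Num.Theory.
Import numFieldNormedType.Exports.
Local Open Scope classical_set_scope.
Local Open Scope ring_scope.

Inductive btree : Type := Leaf | Node of btree & btree.

Fixpoint btree_encode (t : btree) : GenTree.tree unit :=
  if t is Node l r then GenTree.Node 0 [:: btree_encode l; btree_encode r]
  else GenTree.Leaf tt.

Fixpoint btree_decode (t : GenTree.tree unit) : btree :=
  if t is GenTree.Node _ [:: l; r] then Node (btree_decode l) (btree_decode r)
  else Leaf.

Lemma btree_encodeK : cancel btree_encode btree_decode.
Proof. by elim=> //= l -> r ->. Qed.

HB.instance Definition _ := Countable.copy btree (can_type btree_encodeK).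
HB.instance Definition _ := isPointed.Build btree Leaf.
HB.instance Definition _ := @isMeasurable.Build default_measure_display
  btree discrete_measurable discrete_measurable0
  discrete_measurableC discrete_measurableU.

(* A vertex is coded by the path leading to it from the root: [false] is a
   step to the left child, [true] a step to the right child. *)
Fixpoint addresses (t : btree) : seq (seq bool) :=
  [::] :: if t is Node l r then
    map (cons false) (addresses l) ++ map (cons true) (addresses r) else [::].

Notation vertex t := (seq_sub (addresses t)).

Definition leaves (t : btree) : {set vertex t} :=
  [set v : vertex t | [forall w : vertex t,
     prefix (val v) (val w) ==> (w == v)]].

Definition nleaves (t : btree) : nat := #|leaves t|.

(* The vertex [v] is cut off together with its subtree [u], and replaced by a
   copy of the three-vertex tree of which [u] becomes the left ([b = false])
   or the right ([b = true]) subtree. *)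
Fixpoint graft (t : btree) (v : seq bool) (b : bool) : btree :=
  match v, t with
  | [::], u => if b then Node Leaf u else Node u Leaf
  | false :: v', Node l r => Node (graft l v' b) r
  | true :: v', Node l r => Node l (graft r v' b)
  | _ :: _, Leaf => Leaf
  end.

Definition remy_step (R : realType) (s t : btree) : R :=
  #|[pred c : vertex s * bool | graft s (val c.1) c.2 == t]|%:R
  / #|{: vertex s * bool}|%:R.

(* A realization, on some probability space, of the chain started at [s]. *)
Record remy_chain (R : realType) (s : btree) := RemyChain {
  chain_display : measure_display;
  chain_space : measurableType chain_display;
  chain_prob : probability chain_space R;
  chain_state :> nat -> chain_space -> btree;
  chain_measurable : forall n, measurable_fun setT (chain_state n);
  chain_init : chain_prob [set w | chain_state 0 w = s] = 1%E;
  chain_markov : forall (n : nat) (x : nat -> btree),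
    chain_prob [set w | forall i, (i <= n.+1)%N -> chain_state i w = x i] =
    (chain_prob [set w | forall i, (i <= n)%N -> chain_state i w = x i] *
     (remy_step R (x n) (x n.+1))%:E)%E
}.

Lemma addresses_uniq t : uniq (addresses t).
Proof.
elim: t => //= l IHl r IHr; rewrite cat_uniq !map_inj_uniq ?IHl ?IHr /=;
  try by move=> ? ? [].
rewrite andbT mem_cat; apply/andP; split.
  by rewrite negb_or; apply/andP; split; apply/negP => /mapP[].
by apply/hasPn => _ /mapP[w _ ->]; apply/negP => /mapP[].
Qed.

Lemma card_vertex t : #|{: vertex t}| = size (addresses t).
Proof. exact/card_seq_sub/addresses_uniq. Qed.

Lemma size_graft t v b : v \in addresses t ->
  size (addresses (graft t v b)) = (size (addresses t)).+2.
Proof.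
have h : forall u : btree,
    size (addresses (if b then Node Leaf u else Node u Leaf)) =
    (size (addresses u)).+2.
  by move=> u; case: b; rewrite /= ?size_cat !size_map /= ?addn1.
elim: t v => [|l IHl r IHr] v.
  by rewrite inE => /eqP ->; rewrite /= h.
rewrite [addresses _]/= inE => /orP[/eqP ->|]; first exact: h.
rewrite mem_cat => /orP[] /mapP[w wl ->];
  by rewrite /= !size_cat !size_map ?(IHl _ wl) ?(IHr _ wl) ?addnS ?addSn.
Qed.

Section unit_interval_prob.
Variable R : realType.

Let unit_interval_measurable : measurable (`[0, 1[%classic : set R).
Proof. exact: measurable_itv. Qed.

Definition unit_interval_prob : set (measurableTypeR R) -> \bar R :=
  mrestr lebesgue_measure unit_interval_measurable.

HB.instance Definition _ := Measure.copy unit_interval_prob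
  (mrestr lebesgue_measure unit_interval_measurable).

Let unit_interval_prob_setT : unit_interval_prob setT = 1%E.
Proof.
rewrite /unit_interval_prob /mrestr setTI lebesgue_measure_itv /= lte_fin ltr01.
by rewrite oppr0 adde0.
Qed.

HB.instance Definition _ := Measure_isProbability.Build _ _ _
  unit_interval_prob unit_interval_prob_setT.

End unit_interval_prob.

Section remy_chain_exists.
Variables (R : realType) (s : btree).

Let P := @unit_interval_prob R.

(* The chain is driven by the digits, in the mixed radix [N 0, N 1, ...], of a
   uniform random point of the unit interval. *)
Let N k := (2 * (size (addresses s) + 2 * k))%N.
Let M k := (\prod_(i < k) N i)%N.

Let children t := [seq graft t (val c.1) c.2 | c <- enum {: vertex t * bool}].
Fixpoint digit_state (k j : nat) : btree :=
  if k is k'.+1 then nth Leaf (children (digit_state k' (j %/ N k'))) (j %% N k')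
  else s.
Let digit k (u : R) := Num.truncn (u * (M k)%:R).

Let N_gt0 k : (0 < N k)%N.
Proof. by rewrite /N; case: (s). Qed.

Let M_gt0 k : (0 < M k)%N.
Proof. by rewrite /M; elim/big_rec: _ => // i x _ ?; rewrite muln_gt0 N_gt0. Qed.

Let MS k : M k.+1 = (M k * N k)%N.
Proof. by rewrite /M big_ord_recr. Qed.

Let size_children t : size (children t) = (2 * size (addresses t))%N.
Proof. by rewrite size_map -cardE card_prod card_bool card_vertex mulnC. Qed.

Let size_digit_state k j : size (addresses (digit_state k j)) = (size (addresses s) + 2 * k)%N.
Proof.
elim: k j => [|k IH] j /=; first by rewrite muln0 addn0.
set t := digit_state k _.
have st : size (addresses t) = (size (addresses s) + 2 * k)%N by exact: IH.
have lt : (j %% N k < size (children t))%N.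
  by rewrite size_children st ltn_mod N_gt0.
have /mapP[c _ ->] := mem_nth Leaf lt.
by rewrite size_graft ?(valP c.1)// st mulnS add2n !addnS.
Qed.

Let children_state k j : size (children (digit_state k j)) = N k.
Proof. by rewrite size_children size_digit_state. Qed.

Let digit_lt k u : 0 <= u < 1 -> (digit k u < M k)%N.
Proof.
case/andP=> u0 u1; rewrite truncn_lt_nat ?mulr_ge0//.
by rewrite gtr_pMl // ltr0n M_gt0.
Qed.

Let digit_itv k u j : 0 <= u -> (digit k u == j) =
  (j%:R / (M k)%:R <= u < j.+1%:R / (M k)%:R).
Proof.
move=> u0; rewrite truncn_eq ?mulr_ge0//.
by rewrite ler_pdivrMr ?ltr_pdivlMr ?ltr0n ?M_gt0.
Qed.

Let digitS k u : 0 <= u -> (digit k.+1 u %/ N k)%N = digit k u.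
Proof.
move=> u0; apply/esym/eqP; rewrite digit_itv//.
have := eqxx (digit k.+1 u); rewrite {1}digit_itv// MS natrM.
set j := digit k.+1 u => /andP[ju uj].
have M0 : 0 < (M k)%:R :> R by rewrite ltr0n.
have N0 : 0 < (N k)%:R :> R by rewrite ltr0n.
rewrite ler_pdivrMr// ltr_pdivlMr//.
move: ju uj; rewrite ler_pdivrMr ?mulr_gt0// ltr_pdivlMr ?mulr_gt0//.
rewrite mulrA => ju uj; apply/andP; split.
  rewrite -(ler_pM2r N0); apply: le_trans ju.
  by rewrite -natrM ler_nat leq_divM.
rewrite -(ltr_pM2r N0); apply: lt_le_trans uj _.
by rewrite -natrM ler_nat ltn_ceil.
Qed.

Let digit_measurable k j : measurable [set u : R | digit k u = j].
Proof.
have le_meas n : measurable [set u : R | (digit k u <= n)%N].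
  rewrite (_ : [set _ | _] = `]-oo, (n.+1%:R / (M k)%:R)[%classic).
    exact: measurable_itv.
  apply/seteqP; split=> u /=; rewrite in_itv /= truncn_le_nat;
  by rewrite ltr_pdivlMr ?ltr0n ?M_gt0.
case: j => [|j].
  rewrite (_ : [set _ | _] = [set u : R | (digit k u <= 0)%N])//.
  by apply/seteqP; split=> u /=; rewrite leqn0 => /eqP.
rewrite (_ : [set _ | _] = [set u : R | (digit k u <= j.+1)%N] `\`
                           [set u : R | (digit k u <= j)%N]).
  exact: measurableD.
apply/seteqP; split=> u /=; first by move=> ->; rewrite leqnn ltnn.
by case=> h /negP; rewrite -ltnNge => h'; apply/eqP; rewrite eqn_leq h.
Qed.

Let digit_pred_measurable k (Q : nat -> Prop) :
  measurable [set u : R | Q (digit k u)].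
Proof.
rewrite (_ : [set _ | _] = \bigcup_(j in [set j | Q j]) [set u | digit k u = j]).
  exact: bigcup_measurable.
apply/seteqP; split=> u /=; first by move=> Qu; exists (digit k u).
by case=> j /= Qj ->.
Qed.

Let P_digit k (Q : pred nat) :
  P [set u | Q (digit k u)] = ((\sum_(0 <= j < M k) Q j)%N%:R / (M k)%:R)%:E.
Proof.
pose I j := [set u | digit k u = j] `&` `[0, 1[%classic.
have PI (j : 'I_(M k)) : lebesgue_measure (I j) = ((M k)%:R^-1 : R)%:E.
  have M0 : 0 < (M k)%:R :> R by rewrite ltr0n.
  rewrite (_ : I j = `[(j%:R / (M k)%:R), (j.+1%:R / (M k)%:R)[%classic).
    rewrite lebesgue_measure_itv /= lte_fin ltr_pM2r ?invr_gt0// ltr_nat ltnSn.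
    by rewrite -EFinD -mulrBl -natrB// subSnn mul1r.
  apply/seteqP; split=> u /=; rewrite !in_itv /=.
    by case=> + /andP[u0 u1] => /eqP; rewrite digit_itv.
  move=> h; have u0 : 0 <= u.
    by case/andP: h => + _; apply: le_trans; rewrite divr_ge0.
  split; first by apply/eqP; rewrite digit_itv.
  apply/andP; split=> //; case/andP: h => _ /lt_le_trans; apply.
  by rewrite ler_pdivrMr// mul1r ler_nat.
have IM j : measurable (I j) by apply: measurableI.
have -> : P [set u | Q (digit k u)] =
    lebesgue_measure (\big[setU/set0]_(j < M k) (if Q j then I j else set0)).
  rewrite -[X in _ = _ X](bigcup_mkord (M k) (fun j => if Q j then I j else set0)).
  congr (lebesgue_measure _); apply/seteqP; split=> u /=.
    rewrite in_itv /= => -[Qu u01].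
    exists (digit k u); first exact: digit_lt.
    by rewrite Qu; split=> //=; rewrite in_itv.
  case=> j _.
  by case: ifP => // Qj [/= -> ?]; rewrite Qj.
pose F j := if Q j then I j else set0.
rewrite (@measure_bigsetU _ _ _ lebesgue_measure F) /F; last 2 first.
- by move=> i; case: (Q i); [exact: IM|exact: measurable0].
- move=> i j _ _ [u []]; case: ifP => // _ [/= <- _].
  by case: ifP => // _ [/= <- _].
rewrite big_mkord natr_sum mulr_suml -sumEFin; apply: eq_bigr => j _.
case: (Q j); last by rewrite measure0 mul0r. rewrite mul1r. exact: (PI j).
Qed.

Let X k u := digit_state k (digit k u).

Let good (x : nat -> btree) :=
  fix good (n j : nat) : bool := (if n is n'.+1 then good n' (j %/ N n')%N else true) &&
                  (digit_state n j == x n).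

Let goodS x n j :
  good x n.+1 j = good x n (j %/ N n)%N && (digit_state n.+1 j == x n.+1).
Proof. by []. Qed.

Let goodP x n u : 0 <= u ->
  (forall i, (i <= n)%N -> X i u = x i) <-> good x n (digit n u).
Proof.
move=> u0; elim: n => [|n IH].
  split=> [/(_ 0%N (leqnn _)) h|/= /eqP h i]; first by apply/eqP.
  by rewrite leqn0 => /eqP ->.
rewrite goodS digitS//; split=> [h|/andP[/IH h /eqP h'] i].
  apply/andP; split; last by apply/eqP; exact: (h n.+1 (leqnn _)).
  by apply/IH => i le_in; apply: h; exact: leqW.
by rewrite leq_eqVlt => /orP[/eqP ->//|]; rewrite ltnS => /h.
Qed.

Let P_path x n : P [set u | forall i, (i <= n)%N -> X i u = x i] =
  ((\sum_(0 <= j < M n) good x n j)%N%:R / (M n)%:R)%:E.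
Proof.
rewrite -P_digit; congr (lebesgue_measure _); apply/seteqP.
split=> u [h]; rewrite /= in_itv /= => u01; split;
  rewrite /= ?in_itv//=; case/andP: u01 => u0 _; first exact/goodP.
exact/(goodP _ _ u0).
Qed.

Let card_children t u : #|[pred c : vertex t * bool | graft t (val c.1) c.2 == u]| =
  (\sum_(i < size (children t)) (nth Leaf (children t) i == u))%N.
Proof.
rewrite -(big_mkord xpredT (fun i => nat_of_bool (nth Leaf (children t) i == u))).
rewrite -(big_nth Leaf xpredT (fun v => nat_of_bool (v == u))).
rewrite big_map big_enum /= -sum1_card big_mkcond /=.
by apply: eq_bigr => c _; rewrite inE.
Qed.

Let sum_good x n : (\sum_(0 <= j < M n.+1) good x n.+1 j =
  (\sum_(0 <= j < M n) good x n j) *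
  #|[pred c : vertex (x n) * bool | graft (x n) (val c.1) c.2 == x n.+1]|)%N.
Proof.
rewrite MS big_nat_mul big_distrl /=; apply: eq_bigr => j _.
rewrite -{1}[(j * N n)%N]add0n big_addn mulSn addnK big_mkord.
rewrite card_children.
have [gj|gj] := boolP (good x n j); last first.
  rewrite mul0n big1 // => i _.
  by rewrite addnC divnMDl// divn_small// addn0 (negbTE gj).
have xn : digit_state n j = x n by case: n gj => [|n] /=; [move/eqP|case/andP=> _ /eqP].
rewrite mul1n -xn children_state; apply: eq_bigr => i _.
by rewrite addnC /= divnMDl// divn_small// addn0 gj modnMDl modn_small.
Qed.

Let X_measurable n : measurable_fun setT (X n : R -> btree).
Proof.
move=> _ Y _; rewrite setTI.
exact: (digit_pred_measurable n (fun j => Y (digit_state n j))).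
Qed.

Let X_init : P [set u | X 0 u = s] = 1%E.
Proof. by rewrite -(@probability_setT _ _ _ P); congr (P _); apply/seteqP; split. Qed.

Let X_markov n (x : nat -> btree) :
  P [set u | forall i, (i <= n.+1)%N -> X i u = x i] =
  (P [set u | forall i, (i <= n)%N -> X i u = x i] *
   (remy_step R (x n) (x n.+1))%:E)%E.
Proof.
rewrite !P_path sum_good -EFinM; congr EFin.
set S := (\sum_(_ <= _ < _) _)%N.
have [->|S0] := eqVneq S 0%N; first by rewrite mul0n !mul0r.
have card_xn : #|{: vertex (x n) * bool}| = N n.
  have [j _ gj] : exists2 j, j \in index_iota 0 (M n) & good x n j.
    apply/hasP; apply: contraNT S0 => /hasPn h.
    by rewrite /S big_seq big1// => j /h/negbTE ->.
  have xn : digit_state n j = x n by case: (n) gj => [|?] /=; [move/eqP|case/andP=> _ /eqP].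
  by rewrite -(children_state n j) xn size_map -cardE.
rewrite /remy_step card_xn MS !natrM invfM.
by rewrite -!mulrA; congr (_ * _); rewrite mulrCA mulrA [X in X * _]mulrC -!mulrA.
Qed.

Lemma remy_chain_exists : inhabited (remy_chain R s).
Proof.
exact: inhabits (@RemyChain R s _ _ P X X_measurable X_init X_markov).
Qed.

End remy_chain_exists.

Definition hit_prob (R : realType) (s : btree) (X : remy_chain R s)
  (t : btree) : R := fine (chain_prob X [set w | exists n, X n w = t]).

Definition tree3 : Type := {s : btree | (2 < #|{: vertex s}|)%N}.

Lemma aleph_proof : (2 < #|{: vertex (Node Leaf Leaf)}|)%N.
Proof. by rewrite card_seq_sub. Qed.

Definition aleph : tree3 := exist _ (Node Leaf Leaf) aleph_proof.

(* [martin_point X t] is K(., t).  For the one-vertex tree [t = Leaf], which is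
   not a state of the chain, it has the junk value 0. *)
Definition martin_point (R : realType) (X : forall s : tree3, remy_chain R (val s))
  (t : btree) : {ptws tree3 -> R} :=
  fun s => hit_prob (X s) t / hit_prob (X aleph) t.

Definition martin_states (R : realType)
  (X : forall s : tree3, remy_chain R (val s)) : set {ptws tree3 -> R} :=
  [set martin_point X (val t) | t in [set: tree3]].

Definition martin_compactification (R : realType)
  (X : forall s : tree3, remy_chain R (val s)) : set {ptws tree3 -> R} :=
  closure (martin_states X).

Definition martin_boundary (R : realType)
  (X : forall s : tree3, remy_chain R (val s)) : set {ptws tree3 -> R} :=
  martin_compactification X `\` martin_states X.

Definition martin_cvg_to (R : realType)
  (X : forall s : tree3, remy_chain R (val s)) (t : nat -> btree)
  (y : {ptws tree3 -> R}) : Prop :=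
  martin_point X (t k) @[k --> \oo] --> y.

Definition martin_cvg (R : realType)
  (X : forall s : tree3, remy_chain R (val s)) (t : nat -> btree) : Prop :=
  exists2 y, martin_compactification X y & martin_cvg_to X t y.

(* [v] lies below [u], to the left ([b = false]) or to the right ([b = true]) *)
Definition below (t : btree) (b : bool) (u v : vertex t) : bool :=
  prefix (rcons (val u) b) (val v).

Definition is_mrca (t : btree) (v a b : vertex t) : bool :=
  [&& prefix (val v) (val a), prefix (val v) (val b) &
   [forall w : vertex t, prefix (val w) (val a) && prefix (val w) (val b)
      ==> prefix (val w) (val v)]].

Definition span_vertices (t : btree) (A : {set vertex t}) : {set vertex t} :=
  A :|: [set v | [exists a in A, exists b in A, is_mrca v a b]].

(* [s] is, up to the bijection [f], the binary tree with vertex set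
   [span_vertices A] and with the left and right relations of [t].  For a
   nonempty set [A] of leaves there is exactly one such [s]. *)
Definition spans (t : btree) (A : {set vertex t}) (s : btree) : Prop :=
  exists f : vertex s -> vertex t,
    [/\ injective f,
        (forall v, (v \in span_vertices A) <-> (exists u, f u = v)) &
        forall b u w, below b (f u) (f w) = below b u w].

Definition spanned_tree (t : btree) (A : {set vertex t}) : btree :=
  xget Leaf [set s | spans A s].

Definition samples (m : nat) (t : btree) : {set {set vertex t}} :=
  [set A : {set vertex t} | (A \subset leaves t) && (#|A| == m.+1)].

(* The expectation of [f] at the tree spanned by [m.+1] leaves drawn uniformly
   without replacement, i.e. by a uniform random [m.+1]-subset of the leaves.
   It has the junk value 0 if [t] has fewer than [m.+1] leaves. *)
Definition sampled_mean (R : realType) (m : nat) (t : btree) (f : btree -> R) : R :=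
  (\sum_(A in samples m t) f (spanned_tree A)) / #|samples m t|%:R.

(* Convergence in distribution: since [btree] is discrete, the bounded
   continuous test functions are all the bounded functions. *)
Definition sampled_cvg_to (R : realType) (m : nat) (t : nat -> btree)
  (mu : probability btree R) : Prop :=
  forall f : btree -> R, (exists M : R, forall s, `|f s| <= M) ->
    sampled_mean m (t k) f @[k --> \oo] --> \int[mu]_s f s.

(* Main.v *)
From HB Require Import structures.
Require Import Defs.
From mathcomp Require Import all_boot all_order all_algebra.
From mathcomp Require Import all_classical all_reals all_analysis.
From mathcomp Require Import zify ring.
Import Order.TTheory GRing.Theory Num.Theory.
Import numFieldNormedType.Exports.

(** Write [E s t] for the number of sets of leaves of [t] that span [s].  Double
    counting pairs (spanning set, extra leaf) shows that, when [t] runs over the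
    grafts of [s], the sum of [E (graft s) t] equals [(|t| - |s|) E s t], where
    [|.|] counts leaves.  Hence the number of trajectories of the chain from [s]
    to [t] is [(|t| - |s|)! E s t]; as every tree with [a] leaves has
    [2 (2 a - 1)] grafts, dividing by the same expression for the starting tree
    aleph gives [K(s,t) = c P(S_m^t = s)] with [m + 1 = |s|] and a constant [c]
    that depends on [|s|] only.  Convergence in the Doob-Martin topology is thus
    convergence of all sampling probabilities, and this is convergence in
    distribution because there are finitely many trees with [m + 1] leaves.
    The limit is not a state [t0], since the limiting law on the trees with
    [|t0| + 1] leaves has mass 1, whereas [K(s,t0) = 0] for each such [s]. *)

Set Implicit Arguments.
Unset Strict Implicit.
Unset Printing Implicit Defensive.
Local Open Scope nat_scope.

(** * Counting spanning sets of leaves *)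

Fixpoint leaf_count (t : btree) : nat :=
  if t is Node l r then leaf_count l + leaf_count r else 1.

Lemma leaf_count_gt0 t : 0 < leaf_count t.
Proof. by elim: t => //= l IHl r IHr; rewrite addn_gt0 IHl. Qed.

Lemma card_vertex_leaf_count t : #|{: vertex t}|.+1 = 2 * leaf_count t.
Proof.
rewrite card_vertex; elim: t => //= l IHl r IHr.
by rewrite size_cat !size_map mulnDr -IHl -IHr; lia.
Qed.

Lemma leaf_count_graft s v b : v \in addresses s ->
  leaf_count (graft s v b) = (leaf_count s).+1.
Proof.
move=> vs; apply/eqP; rewrite -(eqn_pmul2l (isT : 0 < 2)) mulnS.
by rewrite -!card_vertex_leaf_count !card_vertex size_graft.
Qed.

Lemma leaf_count_tree3 (s : tree3) : 1 < leaf_count (val s).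
Proof. by have := valP s; have := card_vertex_leaf_count (val s); lia. Qed.

Lemma tree3_leaf_count (s : btree) : 1 < leaf_count s -> 2 < #|{: vertex s}|.
Proof. by have := card_vertex_leaf_count s; lia. Qed.

Lemma sum_vertex_bool (s : btree) (F : seq bool -> bool -> nat) :
  \sum_(c : vertex s * bool) F (val c.1) c.2 =
  \sum_(v <- addresses s) (F v true + F v false).
Proof.
rewrite -(pair_bigA _ (fun (v : vertex s) b => F (val v) b)) /=.
rewrite (eq_bigr (fun v : vertex s => F (val v) true + F (val v) false)); last first.
  by move=> v _; rewrite big_bool.
rewrite -[LHS](big_enum _ _ _ (fun v : vertex s => _)) /=.
rewrite -(big_map val predT (fun v => F v true + F v false)) /=.
apply/perm_big/uniq_perm; last 1 first.
- move=> v; apply/mapP/idP => [[u _ ->]|vs]; first exact: valP.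
  by exists (SeqSub vs); rewrite ?mem_enum.
- by rewrite map_inj_uniq ?enum_uniq //; exact: val_inj.
- exact: addresses_uniq.
Qed.

(* [emb_count s t] is the number of sets of leaves of [t] that span [s]. *)
Fixpoint emb_count (s t : btree) : nat :=
  if t is Node l r then
    emb_count s l + emb_count s r +
    (if s is Node sl sr then emb_count sl l * emb_count sr r else 0)
  else s == Leaf.

Lemma emb_count_Leaf t : emb_count Leaf t = leaf_count t.
Proof. by elim: t => //= l -> r ->; rewrite addn0. Qed.

Lemma emb_count_small s t : leaf_count t < leaf_count s -> emb_count s t = 0.
Proof.
elim: t s => [|l IHl r IHr] s /=.
  by case: s => //= sl sr; have := leaf_count_gt0 sl.
move=> lt; have lr := leaf_count_gt0 l; have rl := leaf_count_gt0 r.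
rewrite IHl ?IHr //; try lia.
case: s lt => //= sl sr lt; have [/IHl->//|?] := ltnP (leaf_count l) (leaf_count sl).
by rewrite IHr ?muln0 //; lia.
Qed.

(** A set of that size contains all the leaves of [t], so it spans [t] itself. *)
Lemma emb_count_eq s t : leaf_count s = leaf_count t -> emb_count s t = (s == t).
Proof.
elim: t s => [|l IHl r IHr] [|sl sr] //= st.
- by have := leaf_count_gt0 l; have := leaf_count_gt0 r; lia.
- have lr := leaf_count_gt0 l; have rl := leaf_count_gt0 r.
  rewrite (emb_count_small (t := l)) /=; last by lia.
  rewrite (emb_count_small (t := r)) /= ?add0n; last by lia.
  have -> : (Node sl sr == Node l r) = (sl == l) && (sr == r).
    by apply/eqP/andP => [[-> ->]|[/eqP-> /eqP->]].
  (* Only the product term survives. If the left sizes differ, one of its factors asks for more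
     leaves than the subtree has. *)
  have [lt|lt|eq] := ltngtP (leaf_count sl) (leaf_count l).
  + rewrite (emb_count_small (_ : leaf_count r < leaf_count sr)); last by lia.
    by case: eqP lt => [->|]; rewrite ?ltnn ?muln0.
  + by rewrite emb_count_small //; case: eqP lt => [->|]; rewrite ?ltnn.
  + by rewrite IHl // IHr ?mulnb //; lia.
Qed.

(* Double count the pairs consisting of a set of leaves of [t] that spans [s]
   and a further leaf of [t]. *)
Lemma sum_emb_count_graft s t :
  \sum_(c : vertex s * bool) emb_count (graft s (val c.1) c.2) t
    + leaf_count s * emb_count s t = leaf_count t * emb_count s t.
Proof.
rewrite (sum_vertex_bool s (fun v b => emb_count (graft s v b) t)).
elim: t s => [|l IHl r IHr] s.
  have -> : \sum_(v <- addresses s)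
      (emb_count (graft s v true) Leaf + emb_count (graft s v false) Leaf) = 0.
    rewrite big_seq big1 // => v vs.
    have H b : emb_count (graft s v b) Leaf = 0.
      by apply: emb_count_small; rewrite leaf_count_graft //; exact: leaf_count_gt0.
    by rewrite !H.
  by rewrite add0n; case: s => //= sl sr; rewrite muln0.
(* [pr] counts the sets that meet both [l] and [r]; the other two sums count those inside one of the
   subtrees. *)
pose pr u := if u is Node u1 u2 then emb_count u1 l * emb_count u2 r else 0.
have -> : \sum_(v <- addresses s)
      (emb_count (graft s v true) (Node l r) + emb_count (graft s v false) (Node l r)) =
  \sum_(v <- addresses s)
      (emb_count (graft s v true) l + emb_count (graft s v false) l) +
  \sum_(v <- addresses s)
      (emb_count (graft s v true) r + emb_count (graft s v false) r) +
  \sum_(v <- addresses s) (pr (graft s v true) + pr (graft s v false)).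
  by rewrite -!big_split; apply: eq_bigr => v _; rewrite /= -/(pr _) -/(pr _); lia.
have := IHl s; have := IHr s.
set Sl := \sum_(v <- _) _; set Sr := \sum_(v <- _) _; set Sp := \sum_(v <- _) _.
case: s @Sl @Sr @Sp => [|sl sr] Sl Sr Sp.
  rewrite /Sp big_seq1 /pr /= !emb_count_Leaf => ? ?; lia.
(* A graft at the root of [Node sl sr] puts the whole tree on one side and the new leaf on the
   other; any other graft takes place inside [sl] or [sr]. *)
have -> : Sp = leaf_count l * emb_count (Node sl sr) r
  + leaf_count r * emb_count (Node sl sr) l
  + (\sum_(v <- addresses sl)
      (emb_count (graft sl v true) l + emb_count (graft sl v false) l)) * emb_count sr r
  + emb_count sl l * (\sum_(v <- addresses sr)
      (emb_count (graft sr v true) r + emb_count (graft sr v false) r)).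
  rewrite /Sp [addresses _]/= big_cons big_cat !big_map /= !emb_count_Leaf.
  rewrite -[RHS]addnA; congr (_ + _ + _); first exact: mulnC.
  rewrite big_distrl big_distrr /=; congr (_ + _); apply: eq_bigr => v _.
    by rewrite mulnDl.
  by rewrite mulnDr.
have := IHl sl; have := IHr sr; clear.
set x := \sum_(v <- _) _; set y := \sum_(v <- _) _ => h1 h2 h3 h4.
have -> : emb_count (Node sl sr) (Node l r) = emb_count (Node sl sr) l +
  emb_count (Node sl sr) r + emb_count sl l * emb_count sr r by [].
rewrite [leaf_count (Node l r)]/=. move: h3 h4. rewrite [leaf_count (Node sl sr)]/=.
move: (emb_count (Node _ _) _) (emb_count (Node _ _) _) => p q h3 h4.
move: h1 h2; set e := emb_count sl l; set g := emb_count sr r => h1 h2.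
nia.
Qed.

(** Any two leaves span aleph. This is the double count at [Leaf], whose two grafts are both
    aleph. *)
Lemma emb_count_aleph t : emb_count (val aleph) t = 'C(leaf_count t, 2).
Proof.
have := sum_emb_count_graft Leaf t.
rewrite (sum_vertex_bool Leaf (fun v b => emb_count (graft Leaf v b) t)).
rewrite big_seq1 emb_count_Leaf /= mul1n; have := leaf_count_gt0 t.
have := mul_bin_diag (leaf_count t) 1.
rewrite bin1.
by case: (leaf_count t) => // n; rewrite succnK; move: 'C(_, 2) (emb_count _ _); nia.
Qed.

(** * Enumeration of the trees with a given number of leaves *)

Fixpoint bounded_trees (h : nat) : seq btree :=
  if h is h'.+1 then
    Leaf :: [seq Node l r | l <- bounded_trees h', r <- bounded_trees h']
  else [::].

(** The list holds the trees of height less than [h], and each step to a child loses at least one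
    leaf. *)
Lemma mem_bounded_trees h t : leaf_count t <= h -> t \in bounded_trees h.
Proof.
elim: h t => [|h IH] [|l r] //=; first by have := leaf_count_gt0 l; lia.
have := leaf_count_gt0 l; have := leaf_count_gt0 r => ? ? le.
rewrite inE /=; apply/allpairsPdep; exists l, r; split => //; apply: IH; lia.
Qed.

Definition trees (n : nat) : seq btree :=
  undup [seq t <- bounded_trees n | leaf_count t == n].

Lemma mem_trees n t : (t \in trees n) = (leaf_count t == n).
Proof.
rewrite mem_undup mem_filter; apply: andb_idr => /eqP <-.
exact: mem_bounded_trees.
Qed.

Lemma trees_uniq n : uniq (trees n).
Proof. exact: undup_uniq. Qed.

(** * The tree spanned by a set of leaves *)

Lemma prefix_anti (T : eqType) (u v : seq T) : prefix u v -> prefix v u -> u = v.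
Proof.
move=> /prefixP[w ->] /prefixP[w']; rewrite -catA -[LHS]cats0 => /eqP.
by rewrite eqseq_cat // eqxx /= => /eqP; case: w => //; rewrite cats0.
Qed.

Lemma prefix_rcons_self (T : eqType) (u : seq T) x : prefix (rcons u x) u = false.
Proof. by apply/negP => /size_prefix; rewrite size_rcons ltnn. Qed.

(** The longest common prefix, which is the address of the most recent common ancestor. *)
Fixpoint lcp (u v : seq bool) : seq bool :=
  match u, v with
  | x :: u', y :: v' => if x == y then x :: lcp u' v' else [::]
  | _, _ => [::]
  end.

Lemma prefix_lcp w u v : prefix w (lcp u v) = prefix w u && prefix w v.
Proof.
elim: w u v => [|z w IH] [|x u] [|y v]; rewrite //= ?andbF ?prefix0s //.
have [->|xy] := eqVneq x y; first by rewrite /= IH; case: eqP.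
by case: (z =P x) => //= ->; rewrite (negbTE xy) /= andbF.
Qed.

Lemma lcpp u : lcp u u = u.
Proof. by elim: u => //= x u ->; rewrite eqxx. Qed.

Lemma addresses_prefix t v w : v \in addresses t -> prefix w v -> w \in addresses t.
Proof.
elim: t v w => [|l IHl r IHr] v [|b w] //.
  by rewrite inE => /eqP->.
rewrite [addresses _]/= inE => /orP[/eqP->//|]; rewrite mem_cat.
case/orP => /mapP[u ul ->] /= /andP[/eqP-> wu]; rewrite inE mem_cat /=.
  by rewrite map_f //; exact: IHl ul wu.
by rewrite [X in _ || X]map_f ?orbT //; exact: IHr ul wu.
Qed.

Lemma nil_addresses t : [::] \in addresses t.
Proof. by case: t. Qed.

Lemma mem_addresses_Node l r b v :
  (b :: v \in addresses (Node l r)) = (v \in addresses (if b then r else l)).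
Proof.
rewrite [addresses _]/= inE mem_cat /=.
have inj c : injective (cons c : seq bool -> seq bool) by move=> ? ? [].
case: b; rewrite (mem_map (inj _)).
  by rewrite (_ : (_ \in map _ _) = false) //; apply/mapP => -[? _].
by rewrite orbC (_ : (_ \in map _ _) = false) //; apply/mapP => -[? _].
Qed.

Fixpoint leaf_addresses (t : btree) : seq (seq bool) :=
  if t is Node l r then
    map (cons false) (leaf_addresses l) ++ map (cons true) (leaf_addresses r)
  else [:: [::]].

Lemma mem_leaf_addresses_Node l r b v :
  (b :: v \in leaf_addresses (Node l r)) =
  (v \in leaf_addresses (if b then r else l)).
Proof.
rewrite [leaf_addresses _]/= mem_cat.
have inj c : injective (cons c : seq bool -> seq bool) by move=> ? ? [].
case: b; rewrite (mem_map (inj _)).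
  by rewrite (_ : (_ \in map _ _) = false) //; apply/mapP => -[? _].
by rewrite orbC (_ : (_ \in map _ _) = false) //; apply/mapP => -[? _].
Qed.

Lemma nil_leaf_addresses_Node l r : ([::] \in leaf_addresses (Node l r)) = false.
Proof. by rewrite mem_cat; apply/orP => -[] /mapP[]. Qed.

Lemma leaf_addresses_sub t : {subset leaf_addresses t <= addresses t}.
Proof.
elim: t => [|l IHl r IHr] // [|b v]; first by rewrite nil_addresses.
by rewrite mem_leaf_addresses_Node mem_addresses_Node; case: b => [/IHr|/IHl].
Qed.

Lemma leaf_addresses_uniq t : uniq (leaf_addresses t).
Proof.
elim: t => //= l IHl r IHr; rewrite cat_uniq !map_inj_uniq ?IHl ?IHr /=;
  try by move=> ? ? [].
by rewrite andbT; apply/hasPn => _ /mapP[w _ ->]; apply/mapP => -[].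
Qed.

(** Links the recursive list to the definition of a leaf as a vertex with no other vertex below
    it. *)
Lemma leaf_addressesE t v : v \in addresses t ->
  (v \in leaf_addresses t) = all (fun w => prefix v w ==> (w == v)) (addresses t).
Proof.
elim: t v => [|l IHl r IHr] [|b v] //.
  move=> _; rewrite nil_leaf_addresses_Node; apply/esym/negP => /allP.
  by move/(_ [:: false]); rewrite mem_addresses_Node nil_addresses => /(_ isT).
rewrite mem_addresses_Node mem_leaf_addresses_Node => vb.
rewrite [addresses _]/= /= all_cat !all_map.
have H c (s : seq (seq bool)) :
    all (preim (cons c) (fun w => prefix (b :: v) w ==> (w == b :: v))) s =
    (b != c) || all (fun w => prefix v w ==> (w == v)) s.
  case: (eqVneq b c) => [->|bc].
    by apply: eq_all => w /=; rewrite !eqxx /= eqseq_cons eqxx.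
  by apply/allP => w _ /=; rewrite (negbTE bc).
by rewrite !H; case: b vb {H} => /= vb; rewrite ?IHl ?IHr ?andbT.
Qed.

Lemma mem_leaves t (v : vertex t) : (v \in leaves t) = (val v \in leaf_addresses t).
Proof.
rewrite inE leaf_addressesE ?(valP v) //; apply/forallP/allP => [H w wt|H w].
  by have := H (SeqSub wt); rewrite -val_eqE.
by rewrite -val_eqE; apply: H; exact: valP.
Qed.

Lemma is_mrcaE t (v a b : vertex t) : is_mrca v a b = (val v == lcp (val a) (val b)).
Proof.
apply/and3P/eqP => [[va vb /forallP H]|->].
  have lt : lcp (val a) (val b) \in addresses t.
    apply: (addresses_prefix (valP a)); have := prefix_refl (lcp (val a) (val b)).
    by rewrite prefix_lcp => /andP[].
  apply: prefix_anti; first by rewrite prefix_lcp va.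
  have := H (SeqSub lt) => /implyP; apply.
  by rewrite -prefix_lcp prefix_refl.
have := prefix_refl (lcp (val a) (val b)).
rewrite {1}prefix_lcp => /andP[-> ->]; split => //.
by apply/forallP => w; rewrite prefix_lcp implybb.
Qed.

(** * Recursive construction of the spanned tree, and its uniqueness *)

Definition join_trees (o1 o2 : option btree) : option btree :=
  match o1, o2 with
  | Some s1, Some s2 => Some (Node s1 s2)
  | Some s, None | None, Some s => Some s
  | None, None => None
  end.

(* The tree spanned by the leaves of [t] whose address satisfies [P]. *)
Fixpoint subtree_of (t : btree) (P : pred (seq bool)) : option btree :=
  if t is Node l r then
    join_trees (subtree_of l (P \o cons false)) (subtree_of r (P \o cons true))
  else if P [::] then Some Leaf else None.

Lemma eq_subtree_of t P Q : P =1 Q -> subtree_of t P = subtree_of t Q.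
Proof.
elim: t P Q => [|l IHl r IHr] P Q PQ /=; first by rewrite PQ.
by congr join_trees; [apply: IHl|apply: IHr] => v /=; rewrite PQ.
Qed.

(** The value [None] stands for an empty choice of leaves, hence the default 0. *)
Lemma count_subtree_of t P :
  count P (leaf_addresses t) = oapp leaf_count 0 (subtree_of t P).
Proof.
elim: t P => [|l IHl r IHr] P /=; first by case: (P [::]).
rewrite count_cat !count_map IHl IHr.
by case: (subtree_of l _) (subtree_of r _) => [?|] [?|]; rewrite ?addn0.
Qed.

(** The left-right condition of [spans] on bare addresses, a form that passes to subtrees; [f] is
    arbitrary off [addresses s]. *)
Definition embeds (f : seq bool -> seq bool) (s : btree) : Prop :=
  forall b, {in addresses s &, forall u w,
    prefix (rcons (f u) b) (f w) = prefix (rcons u b) w}.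

Lemma embeds_child f l r : embeds f (Node l r) -> forall b,
  embeds (f \o cons b) (if b then r else l).
Proof.
by move=> ef b c u w us ws; rewrite /= ef ?mem_addresses_Node //= eqxx.
Qed.

Arguments embeds_child {f l r} _ b.

Lemma embeds_below f l r b u : embeds f (Node l r) ->
  b :: u \in addresses (Node l r) -> forall c,
  prefix (rcons (f [::]) c) (f (b :: u)) = (c == b).
Proof.
by move=> ef us c; rewrite ef ?nil_addresses //= prefix0s andbT.
Qed.

Lemma embeds_root f s u : embeds f s -> u \in addresses s -> prefix (f [::]) (f u).
Proof.
case: u => [|b u] ef us; first exact: prefix_refl.
apply: (prefix_trans (prefix_rcons _ b)); rewrite ef ?nil_addresses //=.
by rewrite eqxx prefix0s.
Qed.

(** The first step of an address can be read off its image, which lies below [f [::]] on that side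
    and not on the other. *)
Lemma embeds_inj f s : embeds f s -> {in addresses s &, injective f}.
Proof.
elim: s f => [|l IHl r IHr] f ef u w; first by rewrite !inE => /eqP-> /eqP->.
have H b v : b :: v \in addresses (Node l r) -> f [::] <> f (b :: v).
  move=> vs E; have := embeds_below ef vs b.
  by rewrite -E prefix_rcons_self eqxx.
case: u w => [|b u] [|c w] us ws //; [by move/(H _ _ ws)|by move/esym/(H _ _ us)|].
move=> E; have bc : b = c.
  have := embeds_below ef us b; rewrite eqxx E.
  by rewrite (embeds_below ef ws) => /eqP.
rewrite -bc in ws E *; congr cons; move: us ws E; rewrite !mem_addresses_Node => us ws E.
have ec := embeds_child ef b.
case: b us ws E ec {bc} => us ws E ec.
  exact: (IHr _ ec _ _ us ws E).
exact: (IHl _ ec _ _ us ws E).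
Qed.

Lemma embeds_image_child f l r b v : embeds f (Node l r) ->
  (v \in map (f \o cons b) (addresses (if b then r else l))) =
  (v \in map f (addresses (Node l r))) && prefix (rcons (f [::]) b) v.
Proof.
move=> ef; apply/mapP/andP => [[u us ->]|[/mapP[u us ->]]].
  split; first by apply: (map_f f); rewrite mem_addresses_Node.
  by rewrite [(_ \o _) _]/= (embeds_below ef) ?mem_addresses_Node.
case: u us => [|c u] us; first by rewrite prefix_rcons_self.
rewrite (embeds_below ef us) => /eqP bc; rewrite -bc in us *.
by exists u => //; rewrite mem_addresses_Node in us.
Qed.

(** Uniqueness of the spanned tree: the image determines [f [::]], its least element for [prefix],
    and then the images of the two subtrees, to which induction applies. *)
Lemma embeds_image_tree s s' f f' : embeds f s -> embeds f' s' ->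
  map f (addresses s) =i map f' (addresses s') -> s = s'.
Proof.
(* The image of a [Node] has two distinct points and that of [Leaf] only one, so [s] and [s'] have
   the same shape at the root. *)
have HL l r g : embeds g (Node l r) ->
    exists2 b, g [::] <> g [:: b] & [:: b] \in addresses (Node l r).
  move=> eg; have vs : [:: false] \in addresses (Node l r).
    by rewrite mem_addresses_Node nil_addresses.
  exists false => // E; have := embeds_below eg vs false.
  by rewrite -E prefix_rcons_self.
elim: s s' f f' => [|l IHl r IHr] [|l' r'] f f' ef ef' eqV //.
- have [b ne bs] := HL _ _ _ ef'; case: ne.
  have := eqV (f' [::]); have := eqV (f' [:: b]).
  by rewrite !(map_f f') ?nil_addresses // !inE => /eqP-> /eqP->.
- have [b ne bs] := HL _ _ _ ef; case: ne.
  have := eqV (f [::]); have := eqV (f [:: b]).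
  by rewrite !(map_f f) ?nil_addresses // !inE => /esym/eqP-> /esym/eqP->.
have E0 : f [::] = f' [::].
  apply: prefix_anti.
    have /mapP[u us ->] : f' [::] \in map f (addresses (Node l r)).
      by rewrite eqV map_f.
    exact: embeds_root ef us.
  have /mapP[u us ->] : f [::] \in map f' (addresses (Node l' r')).
    by rewrite -eqV map_f.
  exact: embeds_root ef' us.
have Eb b v : (v \in map (f \o cons b) (addresses (if b then r else l))) =
    (v \in map (f' \o cons b) (addresses (if b then r' else l'))).
  by rewrite !embeds_image_child // eqV E0.
congr Node.
  exact: (IHl _ _ _ (embeds_child ef false) (embeds_child ef' false) (Eb false)).
exact: (IHr _ _ _ (embeds_child ef true) (embeds_child ef' true) (Eb true)).
Qed.

Lemma subtree_of_None t P : subtree_of t P = None ->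
  {in leaf_addresses t, forall v, ~~ P v}.
Proof.
move=> E v vt; apply/negP => Pv; have := count_subtree_of t P; rewrite E /=.
by move/eqP; rewrite -leqn0 leqNgt -has_count => /hasPn/(_ v vt); rewrite Pv.
Qed.

(** Existence of the spanned tree: if both sides contain chosen leaves, the root is kept and the two
    embeddings are glued; otherwise the embedding of the nonempty side is shifted. The pairs with
    [a = b] give the chosen leaves themselves. *)
Lemma subtree_of_embeds t P s : subtree_of t P = Some s ->
  exists2 f, embeds f s & forall v, v \in map f (addresses s) <->
    exists a b, [/\ a \in leaf_addresses t, b \in leaf_addresses t,
      P a, P b & v = lcp a b].
Proof.
elim: t P s => [|l IHl r IHr] P s /=.
  case: ifP => // P0 [<-]; exists id; first by [].
  move=> v; rewrite inE; split => [/eqP->|]; first by exists [::], [::].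
  by case=> a [b []]; rewrite !inE => /eqP-> /eqP-> _ _ ->.
case El: (subtree_of l _) => [sl|]; case Er: (subtree_of r _) => [sr|] //= [<-].
- have [fl efl imfl] := IHl _ _ El; have [fr efr imfr] := IHr _ _ Er.
  pose f u := if u is b :: u' then b :: (if b then fr else fl) u' else [::].
  exists f.
    move=> b [|[] u] [|[] w] //; rewrite !mem_addresses_Node //= ?prefix0s ?eqxx //=;
      by [exact: efr|exact: efl].
  (* One chosen leaf on each side exhibits the root as a common ancestor. *)
  have [al alt Pal] : exists2 a, a \in leaf_addresses l & P (false :: a).
    have := (imfl (fl [::])).1 (map_f _ (nil_addresses _)).
    by case=> a [b [? _ Pa _ _]]; exists a.
  have [ar art Par] : exists2 a, a \in leaf_addresses r & P (true :: a).
    have := (imfr (fr [::])).1 (map_f _ (nil_addresses _)).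
    by case=> a [b [? _ Pa _ _]]; exists a.
  move=> v; split.
    case/mapP => -[|b u] us ->.
      by exists (false :: al), (true :: ar); rewrite !mem_leaf_addresses_Node.
    move: us; rewrite mem_addresses_Node => us.
    have [a [c [at_ ct Pa Pc E]]] : exists a c,
        [/\ a \in leaf_addresses (if b then r else l),
            c \in leaf_addresses (if b then r else l),
            P (b :: a), P (b :: c) & (if b then fr else fl) u = lcp a c].
      by case: b us => us; [apply/imfr/map_f|apply/imfl/map_f].
    by exists (b :: a), (b :: c); rewrite !mem_leaf_addresses_Node /= eqxx E.
  case=> -[|x a] [[|y b] []]; rewrite ?nil_leaf_addresses_Node //.
  rewrite !mem_leaf_addresses_Node => at_ bt Pa Pb ->{v}.
  have [E|xy] := eqVneq x y; last first.
    by rewrite [lcp _ _]/= (negbTE xy); exact: (map_f f (nil_addresses _)).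
  rewrite -{}E in bt Pb *; rewrite [lcp _ _]/= eqxx.
  have /mapP[u us ->] :
      lcp a b \in map (if x then fr else fl) (addresses (if x then sr else sl)).
    by case: x at_ bt Pa Pb => ? ? ? ?; [apply/imfr|apply/imfl]; exists a, b.
  by apply: (map_f f (x := x :: u)); rewrite mem_addresses_Node; case: (x) us.
- have [f ef imf] := IHl _ _ El; exists (cons false \o f).
    by move=> b u w us ws /=; rewrite ef.
  have PrN := subtree_of_None Er.
  move=> v; split.
    case/mapP => u us -> /=; have [a [b [? ? ? ? ->]]] := (imf (f u)).1 (map_f _ us).
    by exists (false :: a), (false :: b); rewrite !mem_leaf_addresses_Node.
  case=> -[|x a] [[|y b] []]; rewrite ?nil_leaf_addresses_Node //.
  rewrite !mem_leaf_addresses_Node.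
  case: x => [/PrN /= /negbTE-> //|]; case: y => [_ /PrN /= /negbTE-> //|].
  move=> al bl Pa Pb -> /=; rewrite map_comp; apply: map_f.
  by apply/imf; exists a, b.
- have [f ef imf] := IHr _ _ Er; exists (cons true \o f).
    by move=> b u w us ws /=; rewrite ef.
  have PlN := subtree_of_None El.
  move=> v; split.
    case/mapP => u us -> /=; have [a [b [? ? ? ? ->]]] := (imf (f u)).1 (map_f _ us).
    by exists (true :: a), (true :: b); rewrite !mem_leaf_addresses_Node.
  case=> -[|x a] [[|y b] []]; rewrite ?nil_leaf_addresses_Node //.
  rewrite !mem_leaf_addresses_Node.
  case: x => [|/PlN /= /negbTE-> //]; case: y => [|_ /PlN /= /negbTE-> //].
  move=> al bl Pa Pb -> /=; rewrite map_comp; apply: map_f.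
  by apply/imf; exists a, b.
Qed.

(** * Agreement of the recursive construction with [spanned_tree] *)

Definition root_vertex t : vertex t := SeqSub (nil_addresses t).

Definition address_pred t (A : {set vertex t}) : pred (seq bool) :=
  fun p => [exists v in A, val v == p].

Lemma address_predE t (A : {set vertex t}) v : address_pred A (val v) = (v \in A).
Proof.
apply/exists_inP/idP => [[w wA /eqP/val_inj <-]|vA] //.
by exists v.
Qed.

(** A chosen vertex is its own common ancestor with itself, so the two clauses of [span_vertices]
    merge. *)
Lemma mem_span_vertices t (A : {set vertex t}) v : (v \in span_vertices A) <->
  exists a b, [/\ a \in A, b \in A & val v = lcp (val a) (val b)].
Proof.
rewrite !inE; split.
  case/orP => [vA|/exists_inP[a aA /exists_inP[b bA]]].
    by exists v, v; rewrite lcpp.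
  by rewrite is_mrcaE => /eqP; exists a, b.
case=> a [b [aA bA E]]; apply/orP; right.
by apply/exists_inP; exists a => //; apply/exists_inP; exists b; rewrite // is_mrcaE E.
Qed.

Lemma spans_embeds t (A : {set vertex t}) s : spans A s ->
  exists2 f, embeds f s & forall v, v \in map f (addresses s) <->
    exists2 w, w \in span_vertices A & val w = v.
Proof.
(* [f] extends [g] to all addresses, with the image of the root as default value off
   [addresses s]. *)
case=> g [ginj gim gb]; pose f u := val (g (insubd (root_vertex s) u)).
have fE (u : vertex s) : f (val u) = val (g u) by rewrite /f valKd.
exists f.
  move=> b u w us ws.
  by rewrite -[u]/(val (SeqSub us)) -[w]/(val (SeqSub ws)) !fE; exact: gb.
move=> v; split.
  case/mapP => u us ->; rewrite -[u]/(val (SeqSub us)) fE.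
  by exists (g (SeqSub us)) => //; apply/gim; exists (SeqSub us).
by case=> w /gim[u <-] <-; rewrite -fE map_f //; exact: valP.
Qed.

Lemma subtree_of_spans t (A : {set vertex t}) s : A \subset leaves t ->
  subtree_of t (address_pred A) = Some s -> spans A s.
Proof.
move=> /fintype.subsetP At /subtree_of_embeds[f ef imf].
have ft (u : vertex s) : f (val u) \in addresses t.
  have [a [b [/leaf_addresses_sub at_ _ _ _ ->]]] := (imf _).1 (map_f f (valP u)).
  apply: (addresses_prefix at_); have := prefix_refl (lcp a b).
  by rewrite prefix_lcp => /andP[].
exists (fun u => SeqSub (ft u)); split.
- by move=> u w /(congr1 val) /= /(embeds_inj ef) E; apply/val_inj/E; exact: valP.
- move=> v; split.
    move=> /mem_span_vertices[a [b [aA bA E]]].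
    have /imf/mapP[u us E'] : exists a b, [/\ a \in leaf_addresses t,
        b \in leaf_addresses t, address_pred A a, address_pred A b & val v = lcp a b].
      by exists (val a), (val b); rewrite -!mem_leaves !address_predE !At.
    by exists (SeqSub us); apply/val_inj; rewrite /= -E'.
  case=> u <-; apply/mem_span_vertices.
  have [a [b [at_ bt]]] := (imf _).1 (map_f f (valP u)).
  case/exists_inP => a' aA /eqP <- /exists_inP[b' bA /eqP <-] E.
  by exists a', b'.
- move=> b u w; rewrite /below /=; apply: ef; exact: valP.
Qed.

(** Two trees spanned by [A] have the same image [span_vertices A] in [t], so they are equal and the
    choice made by [xget] is determined. *)
Lemma subtree_of_spanned_tree t (A : {set vertex t}) s : A \subset leaves t ->
  subtree_of t (address_pred A) = Some s -> spanned_tree A = s.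
Proof.
move=> At /(subtree_of_spans At) As; apply: xget_unique => // s' As'.
have [f ef imf] := spans_embeds As; have [f' ef' imf'] := spans_embeds As'.
apply: (embeds_image_tree ef' ef) => v.
by apply/idP/idP => [/imf'/imf|/imf/imf'].
Qed.

Lemma card_subtree_of t (A : {set vertex t}) : A \subset leaves t ->
  #|A| = oapp leaf_count 0 (subtree_of t (address_pred A)).
Proof.
move=> /fintype.subsetP At; rewrite -count_subtree_of.
rewrite -size_filter cardE -(size_map val); apply/perm_size/uniq_perm.
- by rewrite map_inj_uniq ?enum_uniq //; exact: val_inj.
- exact/filter_uniq/leaf_addresses_uniq.
move=> p; rewrite mem_filter.
apply/mapP/andP => [[v vA ->]|[/exists_inP[v vA /eqP<-] _]].
  by rewrite mem_enum in vA; rewrite address_predE -mem_leaves At.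
by exists v; rewrite ?mem_enum.
Qed.

(** * Leaf sets of a tree and of its two subtrees *)

Section subsets_of_leaves.
Variables l r : btree.
Let t := Node l r.

Definition left_vertex (v : vertex l) : vertex t :=
  insubd (root_vertex t) (false :: val v).
Definition right_vertex (v : vertex r) : vertex t :=
  insubd (root_vertex t) (true :: val v).

Lemma val_left_vertex v : val (left_vertex v) = false :: val v.
Proof. by rewrite insubdK // mem_addresses_Node (valP v). Qed.

Lemma val_right_vertex v : val (right_vertex v) = true :: val v.
Proof. by rewrite insubdK // mem_addresses_Node (valP v). Qed.

Lemma left_vertex_inj : injective left_vertex.
Proof.
by move=> u v /(congr1 val); rewrite !val_left_vertex => -[/val_inj].
Qed.

Lemma right_vertex_inj : injective right_vertex.
Proof.
by move=> u v /(congr1 val); rewrite !val_right_vertex => -[/val_inj].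
Qed.

Definition join_sets (p : {set vertex l} * {set vertex r}) : {set vertex t} :=
  left_vertex @: p.1 :|: right_vertex @: p.2.

Definition split_set (A : {set vertex t}) : {set vertex l} * {set vertex r} :=
  (left_vertex @^-1: A, right_vertex @^-1: A).

Lemma left_right_neq u v : left_vertex u = right_vertex v -> False.
Proof. by move/(congr1 val); rewrite val_left_vertex val_right_vertex. Qed.

Lemma mem_join_left p v : (left_vertex v \in join_sets p) = (v \in p.1).
Proof.
rewrite inE mem_imset; last exact: left_vertex_inj.
by apply/orb_idr => /imsetP[u _ /left_right_neq].
Qed.

Lemma mem_join_right p v : (right_vertex v \in join_sets p) = (v \in p.2).
Proof.
rewrite inE (mem_imset _ _ right_vertex_inj).
by apply/orb_idl => /imsetP[u _ /esym/left_right_neq].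
Qed.

Lemma join_setsK : cancel join_sets split_set.
Proof.
case=> Al Ar; congr pair; apply/setP => v; rewrite inE.
  exact: mem_join_left.
exact: mem_join_right.
Qed.

Lemma vertex_Node (v : vertex t) :
  [\/ v = root_vertex t, exists u, v = left_vertex u | exists u, v = right_vertex u].
Proof.
case: v => -[|[] v] vt; first by constructor 1; apply/val_inj.
  have vr := vt; rewrite mem_addresses_Node in vr; constructor 3.
  by exists (SeqSub vr); apply/val_inj; rewrite /= val_right_vertex.
have vl := vt; rewrite mem_addresses_Node in vl; constructor 2.
by exists (SeqSub vl); apply/val_inj; rewrite /= val_left_vertex.
Qed.

Lemma leaves_left v : (left_vertex v \in leaves t) = (v \in leaves l).
Proof. by rewrite !mem_leaves val_left_vertex mem_leaf_addresses_Node. Qed.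

Lemma leaves_right v : (right_vertex v \in leaves t) = (v \in leaves r).
Proof. by rewrite !mem_leaves val_right_vertex mem_leaf_addresses_Node. Qed.

Lemma root_not_leaf : (root_vertex t \in leaves t) = false.
Proof. by rewrite mem_leaves nil_leaf_addresses_Node. Qed.

(** The only vertex that splitting forgets is the root, which is not a leaf. *)
Lemma split_setK (A : {set vertex t}) : A \subset leaves t -> join_sets (split_set A) = A.
Proof.
move=> /fintype.subsetP At; apply/setP => v.
have [->|[u ->]|[u ->]] := vertex_Node v.
- rewrite [RHS](contraFF (At _) root_not_leaf) inE.
  apply/negP => /orP[] /imsetP[u _ /(congr1 val)].
    by rewrite val_left_vertex.
  by rewrite val_right_vertex.
- by rewrite mem_join_left inE.
- by rewrite mem_join_right inE.
Qed.

Lemma join_sets_leaves p : (join_sets p \subset leaves t) =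
  (p.1 \subset leaves l) && (p.2 \subset leaves r).
Proof.
apply/fintype.subsetP/andP => [H|[/fintype.subsetP Hl /fintype.subsetP Hr] v].
  split; apply/fintype.subsetP => v vp.
    by rewrite -leaves_left; apply: H; rewrite mem_join_left.
  by rewrite -leaves_right; apply: H; rewrite mem_join_right.
by case/setUP => /imsetP[u up ->]; rewrite ?leaves_left ?leaves_right; auto.
Qed.

Lemma sum_subset_leaves_Node (F : {set vertex t} -> nat) :
  \sum_(A : {set vertex t} | A \subset leaves t) F A =
  \sum_(Al : {set vertex l} | Al \subset leaves l)
    \sum_(Ar : {set vertex r} | Ar \subset leaves r) F (join_sets (Al, Ar)).
Proof.
rewrite pair_big (reindex_onto join_sets split_set) => [|A]; last exact: split_setK.
apply: eq_big => [p|[Al Ar] _] //.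
by rewrite join_setsK eqxx andbT join_sets_leaves.
Qed.

Lemma subtree_of_join p : subtree_of t (address_pred (join_sets p)) =
  join_trees (subtree_of l (address_pred p.1)) (subtree_of r (address_pred p.2)).
Proof.
congr join_trees; apply: eq_subtree_of => v /=.
  apply/exists_inP/exists_inP => [[w wp /eqP E]|[w wp /eqP<-]].
    case: (vertex_Node w) E wp => [->//|[u ->]|[u ->]].
      by rewrite val_left_vertex mem_join_left => -[<-]; exists u.
    by rewrite val_right_vertex.
  by exists (left_vertex w); rewrite ?mem_join_left ?val_left_vertex.
apply/exists_inP/exists_inP => [[w wp /eqP E]|[w wp /eqP<-]].
  case: (vertex_Node w) E wp => [->//|[u ->]|[u ->]].
    by rewrite val_left_vertex.
  by rewrite val_right_vertex mem_join_right => -[<-]; exists u.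
by exists (right_vertex w); rewrite ?mem_join_right ?val_right_vertex.
Qed.

End subsets_of_leaves.

Lemma sum_subset_leaves_Leaf (F : {set vertex Leaf} -> nat) :
  \sum_(A : {set vertex Leaf} | A \subset leaves Leaf) F A =
  F finset.set0 + F [set: vertex Leaf]%SET.
Proof.
have LT : leaves Leaf = [set: vertex Leaf]%SET.
  by apply/setP => v; rewrite mem_leaves [RHS]inE; exact: valP.
have set0T : finset.set0 != [set: vertex Leaf]%SET :> {set vertex Leaf}.
  by rewrite eq_sym; apply/finset.set0Pn; exists (root_vertex Leaf); rewrite inE.
rewrite LT (bigD1 finset.set0) ?finset.sub0set //=.
rewrite (bigD1 [set: vertex Leaf]%SET) /=; last by rewrite subxx eq_sym.
rewrite big1 ?addn0 // => A /andP[/andP[_ /finset.set0Pn[v vA]]].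
case/eqP; apply/setP => w; rewrite inE.
have vw (u : vertex Leaf) : u = root_vertex Leaf.
  by apply/val_inj; have := valP u; rewrite inE => /eqP.
by rewrite (vw w) -(vw v).
Qed.

Lemma sum_subtree_of_None t :
  \sum_(A : {set vertex t} | A \subset leaves t)
    (subtree_of t (address_pred A) == None) = 1.
Proof.
rewrite (bigD1 finset.set0) ?finset.sub0set //= big1 => [|A /andP[At A0]].
  have := card_subtree_of (finset.sub0set (leaves t)); rewrite cards0.
  by case: subtree_of => //= s; have := leaf_count_gt0 s; case: leaf_count.
by have := card_subtree_of At; case: subtree_of => //= /cards0_eq E; rewrite E eqxx in A0.
Qed.

(** Justifies the recursion of [emb_count]: a set that spans [s] lies on one side of the root, or
    its two nonempty parts span the two children of [s]. In the first case the empty part on the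
    other side can be chosen in one way. *)
Lemma sum_subtree_of_Some s t :
  \sum_(A : {set vertex t} | A \subset leaves t)
    (subtree_of t (address_pred A) == Some s) = emb_count s t.
Proof.
elim: t s => [|l IHl r IHr] s.
  rewrite sum_subset_leaves_Leaf /=.
  have -> : address_pred (finset.set0 : {set vertex Leaf}) [::] = false.
    by apply/exists_inP => -[v]; rewrite inE.
  have -> : address_pred ([set: vertex Leaf]%SET : {set vertex Leaf}) [::].
    by apply/exists_inP; exists (root_vertex Leaf); rewrite ?inE.
  by rewrite add0n eq_sym.
rewrite sum_subset_leaves_Node.
pose xl (A : {set vertex l}) := subtree_of l (address_pred A).
pose xr (A : {set vertex r}) := subtree_of r (address_pred A).
have E Al Ar : (subtree_of (Node l r) (address_pred (join_sets (Al, Ar))) == Some s) =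
    (xl Al == Some s) * (xr Ar == None) + (xl Al == None) * (xr Ar == Some s) +
    (if s is Node sl sr then (xl Al == Some sl) * (xr Ar == Some sr) else 0) :> nat.
  rewrite subtree_of_join /= -/(xl Al) -/(xr Ar).
  case: (xl Al) (xr Ar) => [a|] [b|]; rewrite /= ?muln0 ?mul0n ?addn0 ?muln1 ?mul1n.
  - case: s => //= sl sr; rewrite mulnb; congr nat_of_bool.
    by apply/eqP/andP => [[-> ->]|[/eqP[->] /eqP[->]]].
  - by case: s => *; rewrite ?muln0 ?mul0n ?muln1 ?addn0.
  - by case: s => *; rewrite ?muln0 ?mul0n ?muln1 ?addn0.
  - by case: s.
under eq_bigr => Al _ do under eq_bigr => Ar _ do rewrite E.
have D (f : {set vertex l} -> nat) (g : {set vertex r} -> nat) :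
  \sum_(Al : {set vertex l} | Al \subset leaves l)
    \sum_(Ar : {set vertex r} | Ar \subset leaves r) f Al * g Ar =
  (\sum_(Al : {set vertex l} | Al \subset leaves l) f Al) *
  (\sum_(Ar : {set vertex r} | Ar \subset leaves r) g Ar).
  by rewrite big_distrlr.
under eq_bigr => Al _ do rewrite !big_split /=.
rewrite !big_split /= !D IHl IHr !sum_subtree_of_None muln1 mul1n; congr (_ + _).
case: s E => [|sl sr] _; first by rewrite big1 // => Al _; rewrite big1.
by rewrite D IHl IHr.
Qed.

Lemma nleavesE t : nleaves t = leaf_count t.
Proof.
have := card_subtree_of (subxx (leaves t)); rewrite /nleaves => ->.
rewrite -count_subtree_of.
have -> : count (address_pred (leaves t)) (leaf_addresses t) = size (leaf_addresses t).
  apply/eqP; rewrite -all_count; apply/allP => v vt.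
  have va := leaf_addresses_sub vt.
  by rewrite -[v]/(val (SeqSub va)) address_predE mem_leaves.
by elim: t => //= l IHl r IHr; rewrite size_cat !size_map IHl IHr.
Qed.

Lemma card_samples m t : #|samples m t| = 'C(leaf_count t, m.+1).
Proof. by rewrite -nleavesE /nleaves -cards_draws. Qed.

(** Group the samples by the tree that they span; it has [m.+1] leaves. *)
Lemma sampled_meanE (R : realType) m t (f : btree -> R) : (sampled_mean m t f =
  (\sum_(s <- trees m.+1) f s * (emb_count s t)%:R) / 'C(leaf_count t, m.+1)%:R)%R.
Proof.
rewrite /sampled_mean card_samples; congr (_ / _)%R.
under [RHS]eq_bigr => s _ do rewrite -sum_subtree_of_Some natr_sum mulr_sumr.
rewrite exchange_big /= [RHS](bigID (fun A : {set vertex t} => #|A| == m.+1)) /=.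
(* [emb_count] ranges over leaf sets of every size; those of size other than [m.+1] span no member
   of [trees m.+1] and contribute 0. *)
rewrite [X in (_ + X)%R]big1 ?addr0 => [|A /andP[At Am]]; last first.
  rewrite big_seq big1 // => s; rewrite mem_trees => /eqP sm.
  case: eqP => [E|]; last by rewrite mulr0.
  by move: Am; rewrite (card_subtree_of At) E /= sm eqxx.
apply: eq_big => [A|A]; first by rewrite inE.
rewrite inE => /andP[At /eqP Am].
have := card_subtree_of At; rewrite Am.
case E: (subtree_of t (address_pred A)) => [s|] //= sm.
rewrite (subtree_of_spanned_tree At E) (bigD1_seq s) ?trees_uniq ?mem_trees ?sm //=.
rewrite eqxx mulr1 big1 ?addr0 // => s' ss'.
rewrite (_ : (Some s == Some s') = false) ?mulr0 //.
by apply/eqP => -[E']; rewrite E' eqxx in ss'.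
Qed.

(** * Hitting probabilities and the Martin kernel *)

Local Open Scope classical_set_scope.
Local Open Scope ring_scope.

Lemma card_vertex_bool s : #|{: vertex s * bool}| = (2 * (2 * leaf_count s).-1)%N.
Proof. by rewrite card_prod card_bool -card_vertex_leaf_count mulnC. Qed.

(** The [n]-step probability, decomposed at the first step so that the double count over the grafts
    of the starting tree applies. *)
Fixpoint transition (R : realType) (n : nat) (s t : btree) : R :=
  if n is n'.+1 then
    (\sum_(c : vertex s * bool) transition R n' (graft s (val c.1) c.2) t)
      / #|{: vertex s * bool}|%:R
  else (s == t)%:R.

(** [remy_step] counts the grafts with a given result, so a sum over results becomes a sum over
    grafts. *)
Lemma sum_remy_step (R : realType) (s : btree) (F : btree -> R) :
  \sum_(u <- trees (leaf_count s).+1) remy_step R s u * F u =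
  (\sum_(c : vertex s * bool) F (graft s (val c.1) c.2)) / #|{: vertex s * bool}|%:R.
Proof.
rewrite mulr_suml; under eq_bigr => u _ do
  rewrite /remy_step -sum1_card natr_sum big_mkcond /= !mulr_suml.
rewrite exchange_big /=; apply: eq_bigr => c _.
have gt : graft s (val c.1) c.2 \in trees (leaf_count s).+1.
  by rewrite mem_trees leaf_count_graft // (valP c.1).
rewrite (bigD1_seq _ gt) ?trees_uniq //= inE eqxx mul1r mulrC big1 ?addr0 //.
by move=> u ug; rewrite inE eq_sym (negbTE ug) !mul0r.
Qed.

Lemma sum_remy_step1 (R : realType) (s : btree) :
  \sum_(u <- trees (leaf_count s).+1) remy_step R s u = 1.
Proof.
under eq_bigr => u _ do rewrite -[remy_step R s u]mulr1.
rewrite sum_remy_step sumr_const -[X in X / _]/(_%:R) divff // pnatr_eq0.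
rewrite card_vertex_bool; have := leaf_count_gt0 s; lia.
Qed.

(* [step_product a n] is the number of trajectories of [n] grafts that the
   chain can follow from a tree with [a] leaves. *)
Definition step_product (a n : nat) : nat :=
  (\prod_(i < n) (2 * (2 * (a + i)).-1))%N.

Lemma step_product_recl a n :
  step_product a n.+1 = (2 * (2 * a).-1 * step_product a.+1 n)%N.
Proof.
rewrite /step_product big_ord_recl addn0; congr muln.
by apply: eq_bigr => i _; rewrite lift0 addSnnS.
Qed.

Lemma step_product_gt0 a n : (0 < a)%N -> (0 < step_product a n)%N.
Proof. by move=> a0; rewrite prodn_gt0 // => i; lia. Qed.

Lemma step_product_add a m n :
  step_product a (m + n) = (step_product a m * step_product (a + m) n)%N.
Proof.
rewrite /step_product big_split_ord /=; congr muln.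
by apply: eq_bigr => i _; rewrite addnA.
Qed.

(** Trees with equally many leaves have equally many grafts, so the denominators factor out; the
    double count contributes one factor per step, and these factors build up the factorial. *)
Lemma transitionE (R : realType) n s t : transition R n s t =
  if (leaf_count s + n == leaf_count t)%N
  then (n`! * emb_count s t)%:R / (step_product (leaf_count s) n)%:R else 0.
Proof.
elim: n s => [|n IH] s /=.
  rewrite addn0 /step_product big_ord0 divr1 fact0 mul1n.
  case: (leaf_count s =P _) => [st|st]; first by rewrite emb_count_eq.
  by rewrite (_ : (s == t) = false) //; apply/eqP => E; rewrite E in st.
under eq_bigr => c _ do rewrite IH leaf_count_graft ?(valP c.1) // addSnnS.
case: eqP => [E|_]; last by rewrite big1 ?mul0r.
rewrite -mulr_suml -natr_sum -big_distrr /= step_product_recl card_vertex_bool.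
(* By [E], the leaf difference in the double count is [n.+1]. *)
have -> : (\sum_(c : vertex s * bool) emb_count (graft s (val c.1) c.2) t =
    n.+1 * emb_count s t)%N.
  have := sum_emb_count_graft s t; rewrite -{1}E; lia.
by rewrite mulnCA mulnA -factS -mulrA -invfM -natrM [X in X%:R^-1]mulnC.
Qed.

Lemma measurable_btree (A : set btree) : measurable A.
Proof. by []. Qed.

(** * Law of the chain and its hitting probabilities *)

Section chain.
Variables (R : realType) (s : btree) (X : remy_chain R s).
Let P := chain_prob X.
Let past (n : nat) (x : nat -> btree) := [set w | forall i, (i <= n)%N -> X i w = x i].

Let measurable_state n (A : set btree) : measurable [set w | A (X n w)].
Proof.
have := @chain_measurable _ _ X n measurableT A (measurable_btree A).
by rewrite setTI.
Qed.

Let pastS n x : past n.+1 x = past n x `&` [set w | X n.+1 w = x n.+1].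
Proof.
apply/seteqP; split => [w xw|w [xw xn] i].
  by split => [i ni|]; apply: xw; rewrite ?leqnn // ltnW.
by rewrite leq_eqVlt => /orP[/eqP->//|]; exact: xw.
Qed.

Let measurable_past n x : measurable (past n x).
Proof.
elim: n => [|n IH]; last first.
  rewrite pastS; apply: measurableI => //.
  exact: (measurable_state _ [set x n.+1]).
rewrite (_ : past 0 x = [set w | X 0%N w = x 0%N]).
  exact: (measurable_state _ [set x 0%N]).
apply/seteqP; split => [w xw|w xw i]; first exact: xw.
by rewrite leqn0 => /eqP->.
Qed.

Let P_split B n (L : seq btree) : measurable B -> uniq L ->
  P (B `&` [set w | X n w \in L]) = (\sum_(u <- L) P (B `&` [set w | X n w = u]))%E.
Proof.
move=> mB; elim: L => [|u L IH] /=.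
  rewrite big_nil (_ : _ `&` _ = set0) ?measure0 //.
  by apply/seteqP; split => w [].
case/andP=> uL Lu; rewrite big_cons -IH // -measureU.
- congr (P _); apply/seteqP; split => w /=.
    by case=> Bw; rewrite inE => /orP[/eqP|]; [left|right].
  by case=> -[Bw Xw]; split => //; rewrite inE Xw ?eqxx ?orbT.
- by apply: measurableI => //; exact: (measurable_state _ [set u]).
- by apply: measurableI => //; exact: (measurable_state _ [set` L]).
- apply/seteqP; split => w //= -[[_ ->] [_ uL']].
  by rewrite uL' in uL.
Qed.

Let P_next n x u : P (past n x `&` [set w | X n.+1 w = u]) =
  (P (past n x) * (remy_step R (x n) u)%:E)%E.
Proof.
(* [chain_markov] speaks of a single path, so the path is rerouted through [u] at time [n.+1]. *)
pose x' i := if i == n.+1 then u else x i.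
have x'E i : (i <= n)%N -> x' i = x i.
  by move=> ni; rewrite /x'; case: eqP => // E; rewrite E ltnn in ni.
have pE : past n x' = past n x.
  by apply/seteqP; split => w xw i ni; rewrite xw // x'E.
have := chain_markov X n x'; rewrite -/(past _ _) -/(past n x') pE x'E //.
by rewrite {2}/x' eqxx => <-; rewrite -/P -/(past _ _) pastS pE /x' eqxx.
Qed.

Let P_fin B : measurable B -> P B = (fine (P B))%:E.
Proof. by move=> mB; rewrite fineK // fin_num_measure. Qed.

Let P_DI A B : measurable A -> measurable B ->
  P A = (P (A `\` B) + P (A `&` B))%E.
Proof. exact: measureDI. Qed.

(** The one-step probabilities out of [x n] sum to 1 over finitely many trees, so after this past
    the next state is almost surely one of them. *)
Let P_past_split n x B : measurable B -> P (past n x `&` B) =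
  (\sum_(u <- trees (leaf_count (x n)).+1)
     P (past n x `&` B `&` [set w | X n.+1 w = u]))%E.
Proof.
move=> mB; set L := trees _.
have mL : measurable [set w | X n.+1 w \in L] by exact: (measurable_state _ [set` L]).
have mI : measurable (past n x `&` B) by exact: measurableI.
have H0 : P (past n x `\` [set w | X n.+1 w \in L]) = 0%E.
  have := P_DI (measurable_past n x) mL.
  rewrite P_split ?trees_uniq //.
  under eq_bigr => u _ do rewrite P_next.
  rewrite [P (past n x)]P_fin //; under eq_bigr => u _ do rewrite -EFinM.
  rewrite sumEFin -mulr_sumr sum_remy_step1 mulr1.
  rewrite (P_fin (measurableD (measurable_past n x) mL)) -EFinD => -[/eqP].
  by rewrite -subr_eq subrr => /eqP <-.
rewrite -P_split ?trees_uniq // (P_DI mI mL).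
rewrite [X in (X + _)%E](_ : _ = 0%E) ?add0e //; apply/eqP.
rewrite -measure_le0 -H0; apply: le_measure; rewrite ?inE.
- exact: measurableD.
- exact: measurableD.
- by move=> w [[]].
Qed.

(** Condition on the next state [u]: the past grows by one step, and the induction hypothesis
    applies to the path rerouted through [u]. *)
Let P_future k n x t : P (past n x `&` [set w | X (n + k)%N w = t]) =
  (P (past n x) * (transition R k (x n) t)%:E)%E.
Proof.
elim: k n x => [|k IH] n x.
  rewrite addn0 /=; case: eqP => [E|ne]; last first.
    rewrite mule0 (_ : _ `&` _ = set0) ?measure0 //.
    by apply/seteqP; split => w //= -[xw Xt]; apply: ne; rewrite -Xt xw.
  rewrite mule1; congr (P _); apply/seteqP; split => w; first by case.
  by move=> xw; split => //=; rewrite xw.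
rewrite P_past_split; last exact: (measurable_state _ [set t]).
rewrite [transition _ _ _ _]/= -(sum_remy_step (x n) (fun u => transition R k u t)).
rewrite [P (past n x)]P_fin // -EFinM mulr_sumr -sumEFin; apply: eq_bigr => u _.
pose x' i := if i == n.+1 then u else x i.
have x'E i : (i <= n)%N -> x' i = x i.
  by move=> ni; rewrite /x'; case: eqP => // E; rewrite E ltnn in ni.
have pE : past n x' = past n x.
  by apply/seteqP; split => w xw i ni; rewrite xw // x'E.
have pE' : past n x `&` [set w | X n.+1 w = u] = past n.+1 x'.
  by rewrite pastS pE /x' eqxx.
rewrite setIAC pE' -addSnnS IH -pE' P_next /x' eqxx.
by rewrite !EFinM -P_fin // -muleA.
Qed.

Lemma chain_transition n t :
  chain_prob X [set w | X n w = t] = (transition R n s t)%:E.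
Proof.
have m0 : measurable (past 0 (fun=> s)) by exact: measurable_past.
have mt : measurable [set w | X n w = t] by exact: (measurable_state _ [set t]).
have p0 : P (past 0 (fun=> s)) = 1%E.
  rewrite -(chain_init X); congr (P _); apply/seteqP; split => w.
    by apply.
  by move=> /= Xs i; rewrite leqn0 => /eqP->.
have := P_future n 0 (fun=> s) t; rewrite p0 mul1e add0n => <-.
(* The chain starts at [s] only almost surely; the part of the event outside [past 0] is null. *)
rewrite -/P (P_DI mt m0) [X in (X + _)%E](_ : _ = 0%E).
  by rewrite add0e setIC.
apply/eqP; rewrite -measure_le0 -[leRHS](_ : P (~` past 0 (fun=> s)) = 0%E).
  apply: le_measure; rewrite ?inE; [exact: measurableD|exact: measurableC|].
  by move=> w [].
by rewrite probability_setC // p0 subee.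
Qed.

(** Each step adds one leaf, so outside a null event [t] is hit at time
    [leaf_count t - leaf_count s] or never. *)
Lemma hit_probE t : hit_prob X t =
  if (leaf_count s <= leaf_count t)%N
  then transition R (leaf_count t - leaf_count s) s t else 0.
Proof.
pose n0 := (leaf_count t - leaf_count s)%N.
pose H n := [set w | X n w = t].
have mH n : measurable (H n) by exact: (measurable_state _ [set t]).
have PH n : P (H n) = (transition R n s t)%:E by exact: chain_transition.
rewrite /hit_prob -/P.
have -> : [set w | exists n, X n w = t] =
    H n0 `|` \bigcup_n (if n == n0 then set0 else H n).
  apply/seteqP; split => w /=.
    case=> n Xn; case: (eqVneq n n0) Xn => [->|nn0] Xn; first by left.
    by right; exists n => //; rewrite (negbTE nn0).
  by case=> [|[n _]]; [exists n0|case: eqP => // _; exists n].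
have mU : measurable (\bigcup_n (if n == n0 then set0 else H n)).
  by apply: bigcup_measurable => n _; case: eqP.
have -> : P (H n0 `|` \bigcup_n (if n == n0 then set0 else H n)) = P (H n0).
  apply: measureU0 => //.
  apply: measure_negligible => //; apply: negligible_bigcup => n.
  apply/negligibleP; first by case: eqP.
  case: eqP => [_|nn0]; first by rewrite measure0.
  apply: (etrans (PH n)); rewrite transitionE; case: eqP => // E; case: nn0.
  by rewrite /n0 -E addKn.
(* If [t] has fewer leaves than [s], truncated subtraction makes [n0] zero, and the transition
   probability at time 0 vanishes as well. *)
rewrite PH; case: leqP => // lt; rewrite /= transitionE; case: eqP => // E.
by rewrite -E ltnNge leq_addr in lt.
Qed.

End chain.

(** For [2 <= a] this is the Catalan number of binary trees with [a] leaves, the inverse of the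
    probability that the chain from aleph hits a given one of them. *)
Definition martin_const (R : realType) (a : nat) : R :=
  (2 * step_product 2 (a - 2))%:R / a`!%:R.

Lemma martin_const_gt0 (R : realType) a : 0 < martin_const R a.
Proof.
by rewrite divr_gt0 // ltr0n ?fact_gt0 // muln_gt0 step_product_gt0.
Qed.

Lemma martin_pointE (R : realType) (X : forall s : tree3, remy_chain R (val s)) t s :
  martin_point X t s = martin_const R (leaf_count (val s)) *
    ((emb_count (val s) t)%:R / 'C(leaf_count t, leaf_count (val s))%:R).
Proof.
rewrite /martin_point !hit_probE.
set a := leaf_count (val s); set b := leaf_count t.
have a2 : (2 <= a)%N := leaf_count_tree3 s.
(* If [t] is smaller than [s], both sides are 0; this covers [t = Leaf]. *)
case: (leqP a b) => [ab|ba]; last by rewrite emb_count_small // !mul0r mulr0.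
have b2 : (2 <= b)%N := leq_trans a2 ab.
have -> : leaf_count (val aleph) = 2%N by [].
rewrite b2 !transitionE -/a -/b subnKC // eqxx.
have -> : leaf_count (val aleph) = 2%N by [].
rewrite subnKC // eqxx emb_count_aleph -/b /martin_const.
(* A trajectory from 2 to [b] leaves passes through [a] leaves; the part from [a] to [b] cancels in
   the kernel. *)
have -> : step_product 2 (b - 2) = (step_product 2 (a - 2) * step_product a (b - a))%N.
  rewrite -[X in step_product X (b - a)](subnKC a2) -step_product_add.
  by congr step_product; lia.
have nz n : (0 < n)%N -> n%:R != 0 :> R by rewrite pnatr_eq0 -lt0n.
have S1 := nz _ (step_product_gt0 (a - 2) (isT : 0 < 2)%N).
have S2 := nz _ (step_product_gt0 (b - a) (ltnW a2)).
have C1 : 'C(b, 2)%:R != 0 :> R by rewrite nz // bin_gt0.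
have C2 : 'C(b, a)%:R != 0 :> R by rewrite nz // bin_gt0.
have F1 := nz _ (fact_gt0 (b - 2)); have F2 := nz _ (fact_gt0 a).
have F3 := nz _ (fact_gt0 (b - a)).
(* Both sides are the factorial of [b]. *)
have E : 'C(b, a)%:R * (a`!%:R * (b - a)`!%:R) =
    'C(b, 2)%:R * (2 * (b - 2)`!%:R) :> R.
  by rewrite -!natrM bin_fact // -(bin_fact b2).
rewrite (natrM _ (b - a)`!) (natrM _ (b - 2)`!) !(natrM _ _ (step_product _ _)).
have -> : ('C(b, 2)%:R : R) =
  'C(b, a)%:R * (a`!%:R * (b - a)`!%:R) / (2 * (b - 2)`!%:R).
  by rewrite E mulfK // mulf_neq0 // nz.
field.
by rewrite S1 S2 C2 F1 F2 F3.
Qed.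

(** * Limits of the sampling probabilities *)

Lemma ptws_cvgP (U : Type) (V : topologicalType) (F : set_system (U -> V))
    (f : U -> V) : Filter F ->
  {ptws, F --> f} <-> forall u, g u @[g --> F] --> f u.
Proof.
move=> FF; rewrite cvg_sup.
(* Evaluation at [u] is onto, as [cvg_image] requires for each of the topologies whose supremum is
   the product topology. *)
have surj u : [set g u | g in [set: U -> V]] = [set: V].
  by apply/seteqP; split=> [v|v _]; [|exists (fun=> v)].
split=> H u.
  have := H u; rewrite cvg_image //; apply: cvg_trans => W /=.
  rewrite ?nbhs_simpl /fmap /= => -[W' FW' <-].
  by apply: filterS FW' => g W'g /=; exists g.
rewrite cvg_image //; apply: cvg_trans (H u) => W /=.
rewrite nbhs_simpl => FW; exists (@^~ u @^-1` W) => //.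
apply/seteqP; split=> [v [g Wg <-] //|v Wv]; by exists (fun=> v).
Qed.

Lemma measurable_fun_btree (d : measure_display) (U : sigmaRingType d)
    (D : set btree) (g : btree -> U) : measurable_fun D g.
Proof. by move=> _ Y _. Qed.

#[local] Hint Resolve measurable_fun_btree : core.

Lemma cvg_sum_in (R : realType) (I : eqType) (L : seq I) (f : I -> nat -> R)
    (a : I -> R) : {in L, forall i, f i k @[k --> \oo] --> a i} ->
  \sum_(i <- L) f i k @[k --> \oo] --> \sum_(i <- L) a i.
Proof.
move=> H; rewrite big_seq; under eq_fun do rewrite big_seq.
by apply: cvg_big => //; exact: add_continuous.
Qed.

(** * Probability laws with finite support *)

Section finite_law.
Variables (R : realType) (L : seq btree) (w : btree -> {nonneg R}).

Let law := msum (fun n => mscale (w (nth Leaf L n)) \d_(nth Leaf L n)) (size L).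

(** The proof of total mass 1 is an argument, so that a probability instance can be attached to
    [finite_law]. *)
Definition finite_law (_ : \sum_(s <- L) (w s)%:num = 1) : set btree -> \bar R :=
  law.

HB.instance Definition _ sum_w := Measure.copy (finite_law sum_w) law.

Let finite_law_setT sum_w : finite_law sum_w setT = 1%E.
Proof.
rewrite /finite_law /law /msum.
rewrite -sum_w (big_nth Leaf) big_mkord -sumEFin; apply: eq_bigr => i _.
by rewrite -[RHS]mule1; congr (_ * _)%E; exact: diracT.
Qed.

HB.instance Definition _ sum_w := Measure_isProbability.Build _ _ _
  (finite_law sum_w) (finite_law_setT sum_w).

Lemma Rintegral_finite_law sum_w (f : btree -> R) :
  \int[finite_law sum_w]_s f s = \sum_(s <- L) f s * (w s)%:num.
Proof.
(* Nonnegative functions come first; [f] is then split into its positive and negative parts. *)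
have H (g : btree -> \bar R) : (forall s, 0 <= g s)%E ->
    (\int[finite_law sum_w]_s g s = \sum_(s <- L) (w s)%:num%:E * g s)%E.
  move=> g0; rewrite ge0_integral_measure_sum // (big_nth Leaf) big_mkord.
  apply: eq_bigr => i _; rewrite ge0_integral_mscale // integral_dirac //.
  by rewrite diracT mul1e.
rewrite /Rintegral integralE !H //.
pose fp s := Num.max (f s) 0; pose fn s := Num.max (- f s) 0.
transitivity (fine ((\sum_(s <- L) (w s)%:num * fp s)%:E -
    (\sum_(s <- L) (w s)%:num * fn s)%:E)).
  congr (fine (_ - _)); rewrite -sumEFin; apply: eq_bigr => s _.
    by rewrite EFinM /fp EFin_max funepos.unlock.
  by rewrite EFinM /fn EFin_max EFinN funeneg.unlock.
rewrite -EFinB /= -sumrB; apply: eq_bigr => s _.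
rewrite -mulrBr mulrC; congr (_ * _); rewrite /fp /fn.
case: (leP 0 (f s)) => fs.
  by rewrite max_r ?oppr_le0 // subr0.
by rewrite max_l ?oppr_ge0 ?ltW // sub0r opprK.
Qed.

End finite_law.

Lemma exists_law (R : realType) (L : seq btree) (p : btree -> R) :
  {in L, forall s, 0 <= p s} -> \sum_(s <- L) p s = 1 ->
  exists mu : probability btree R,
    forall f : btree -> R, \int[mu]_s f s = \sum_(s <- L) f s * p s.
Proof.
(* [p] is known to be nonnegative on [L] only; its absolute value gives weights defined everywhere
   that agree with it there. *)
move=> p0 p1; pose q s : {nonneg R} := NngNum (normr_ge0 (p s)).
have qp s : s \in L -> (q s)%:num = p s by move=> /p0 ps; rewrite /= ger0_norm.
have q1 : \sum_(s <- L) (q s)%:num = 1.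
  by rewrite -p1 big_seq [RHS]big_seq; apply: eq_bigr => s /qp.
exists (finite_law q1 : probability _ _) => f; rewrite Rintegral_finite_law.
by rewrite big_seq [RHS]big_seq; apply: eq_bigr => s /qp ->.
Qed.

(* The probability that the tree spanned by [leaf_count s] leaves of [t] is
   [s], or 0 when [t] has fewer leaves. *)
Definition frequency (R : realType) (s t : btree) : R :=
  (emb_count s t)%:R / 'C(leaf_count t, leaf_count s)%:R.

Lemma frequency_ge0 (R : realType) s t : 0 <= frequency R s t.
Proof. by rewrite divr_ge0. Qed.

Lemma frequency_small (R : realType) s t :
  (leaf_count t < leaf_count s)%N -> frequency R s t = 0.
Proof. by move=> st; rewrite /frequency emb_count_small // mul0r. Qed.

Lemma sampled_mean_frequency (R : realType) m t (f : btree -> R) :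
  sampled_mean m t f = \sum_(s <- trees m.+1) f s * frequency R s t.
Proof.
rewrite sampled_meanE mulr_suml big_seq [RHS]big_seq; apply: eq_bigr => s.
by rewrite mem_trees => /eqP sm; rewrite /frequency sm mulrA.
Qed.

Lemma sum_frequency (R : realType) m t : (m < leaf_count t)%N ->
  \sum_(s <- trees m.+1) frequency R s t = 1.
Proof.
move=> mt; have := sampled_mean_frequency m t (fun=> 1 : R).
under [RHS]eq_bigr => s _ do rewrite mul1r.
move=> <-; rewrite /sampled_mean sumr_const divff // pnatr_eq0.
by rewrite card_samples -lt0n bin_gt0.
Qed.

Lemma sampled_mean_indicator (R : realType) m t s : leaf_count s = m.+1 ->
  sampled_mean m t (fun u => (u == s)%:R) = frequency R s t.
Proof.
move=> sm; rewrite sampled_mean_frequency (bigD1_seq s) ?trees_uniq ?mem_trees ?sm //=.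
rewrite eqxx mul1r big1 ?addr0 // => u /negbTE ->; exact: mul0r.
Qed.

(* The limiting frequency of [s] along a sequence that converges to [y]. *)
Definition limit_frequency (R : realType) (y : tree3 -> R) (s : btree) : R :=
  oapp (fun u : tree3 => y u / martin_const R (leaf_count s)) 0 (insub s).

Lemma limit_frequencyE (R : realType) (y : tree3 -> R) (s : tree3) :
  limit_frequency y (val s) = y s / martin_const R (leaf_count (val s)).
Proof. by rewrite /limit_frequency valK. Qed.

Lemma nonleaf_tree3 s : (1 < leaf_count s)%N -> exists u : tree3, val u = s.
Proof. by move=> /tree3_leaf_count s3; exists (exist _ s s3). Qed.

(** At a fixed [s], kernel and frequency differ by the nonzero factor [martin_const], which does not
    depend on [t k]. *)
Lemma martin_cvg_toP (R : realType) (X : forall s : tree3, remy_chain R (val s))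
    (t : nat -> btree) (y : tree3 -> R) :
  martin_cvg_to X t y <-> forall s, (1 < leaf_count s)%N ->
    frequency R s (t k) @[k --> \oo] --> limit_frequency y s.
Proof.
have c0 s : martin_const R (leaf_count s) != 0 by rewrite gt_eqF ?martin_const_gt0.
rewrite /martin_cvg_to; split.
  move/ptws_cvgP => H _ /nonleaf_tree3[s <-]; rewrite limit_frequencyE.
  have -> : (fun k => frequency R (val s) (t k)) =
      (fun k => martin_point X (t k) s / martin_const R (leaf_count (val s))).
    by apply/funext => k; rewrite martin_pointE mulrC mulKf.
  by apply: cvgMr_tmp; exact: (H s).
move=> H; apply/ptws_cvgP => s.
suff : martin_point X (t k) s @[k --> \oo] -->
    martin_const R (leaf_count (val s)) * limit_frequency y (val s).
  by rewrite limit_frequencyE mulrC divfK.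
under eq_fun do rewrite martin_pointE -/(frequency _ _ _).
by apply: cvgMl_tmp; apply: H; exact: leaf_count_tree3.
Qed.

(** * Limits along a sequence of growing trees *)

Section limits.
Variables (R : realType) (X : forall s : tree3, remy_chain R (val s)).
Variables (t : nat -> btree).
Hypothesis t_oo : nleaves (t k) @[k --> \oo] --> \oo.

Lemma near_leaf_count n : \forall k \near \oo, (n <= leaf_count (t k))%N.
Proof.
have H : \forall k \near \oo, (n <= nleaves (t k))%N.
  exact: (t_oo (nbhs_infty_ge n)).
by apply: filterS H => k; rewrite nleavesE.
Qed.

(** No mass escapes: the sum is finite and equals 1 as soon as [t k] has [m.+1] leaves. *)
Lemma sum_limit_frequency (p : btree -> R) m :
  (forall s, leaf_count s = m.+1 -> frequency R s (t k) @[k --> \oo] --> p s) ->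
  \sum_(s <- trees m.+1) p s = 1.
Proof.
move=> H.
have c : \sum_(s <- trees m.+1) frequency R s (t k) @[k --> \oo] -->
    \sum_(s <- trees m.+1) p s.
  by apply: cvg_sum_in => s; rewrite mem_trees => /eqP; exact: H.
apply: (cvg_unique _ c) => //; apply: cvg_near_cst.
by apply: filterS (near_leaf_count m.+1) => k; exact: sum_frequency.
Qed.

(** The weights of [mu] are read off [y], so one law serves every sequence that converges to [y];
    the comparison of two sequences rests on this. *)
Lemma martin_limit_sampled (y : tree3 -> R) m : martin_cvg_to X t y -> (0 < m)%N ->
  exists mu : probability btree R,
    forall u, martin_cvg_to X u y -> sampled_cvg_to m u mu.
Proof.
move=> /martin_cvg_toP ty m0.
have cy s : leaf_count s = m.+1 ->
    frequency R s (t k) @[k --> \oo] --> limit_frequency y s.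
  by move=> sm; apply: ty; rewrite sm.
have [|mu muE] := @exists_law R _ (limit_frequency y) _ (sum_limit_frequency cy).
  move=> s; rewrite mem_trees => /eqP/cy c; apply: (cvgr_to_ge c).
  by apply: nearW => k; exact: frequency_ge0.
exists mu => u /martin_cvg_toP uy f _; rewrite muE.
under eq_fun do rewrite sampled_mean_frequency.
apply: cvg_sum_in => s; rewrite mem_trees => /eqP sm.
by apply: cvgMl_tmp; apply: uy; rewrite sm.
Qed.

Lemma sampled_frequency (mu : probability btree R) m s : sampled_cvg_to m t mu ->
  leaf_count s = m.+1 ->
  frequency R s (t k) @[k --> \oo] --> \int[mu]_u (u == s)%:R.
Proof.
move=> H sm; under eq_fun do rewrite -(sampled_mean_indicator _ _ sm).
by apply: H; exists 1 => u; case: eqP => _; rewrite ?normr1 ?normr0.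
Qed.

Lemma martin_cvg_to_closure (y : tree3 -> R) :
  martin_cvg_to X t y -> martin_compactification X y.
Proof.
move=> ty B By; have := ty B By => /= tB.
(* [t k] is a state of the chain only if it has at least two leaves. *)
have /filter_ex[k [Bk lk]] : \forall k \near \oo,
    B (martin_point X (t k)) /\ (2 <= leaf_count (t k))%N.
  by apply: filterI => //; exact: near_leaf_count.
exists (martin_point X (t k)); split => //.
by have [s <-] := nonleaf_tree3 lk; exists s.
Qed.

Lemma martin_limit_not_state (y : tree3 -> R) :
  martin_cvg_to X t y -> ~ martin_states X y.
Proof.
move=> /martin_cvg_toP ty [s _ sy].
(* The trees in [trees m.+1] have one leaf more than [val s], so the kernel of the state [val s]
   vanishes at all of them. *)
set m := leaf_count (val s); have m0 : (0 < m)%N := ltnW (leaf_count_tree3 s).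
have := @sum_limit_frequency (limit_frequency y) m _.
rewrite big_seq big1 => [H|u].
  suff /esym/eqP : 0 = 1 :> R by rewrite oner_eq0.
  by apply: H => u um; apply: ty; rewrite um.
rewrite mem_trees => /eqP um; have [v vu] : exists v : tree3, val v = u.
  by apply: nonleaf_tree3; rewrite um.
rewrite -vu limit_frequencyE -sy martin_pointE.
rewrite -/(frequency R (val v) (val s)) frequency_small ?mulr0 ?mul0r //.
by rewrite vu um.
Qed.

End limits.

(** * Convergence in the compactification and convergence of the sampled subtrees *)

Theorem corollary3p10 (R : realType)
    (X : forall s : tree3, remy_chain R (val s)) :
  (forall t : nat -> btree,
     nleaves (t k) @[k --> \oo] --> \oo ->
     (martin_cvg X t <->
      forall m, (0 < m)%N ->
        exists mu : probability btree R, sampled_cvg_to m t mu)) /\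
  (forall t' t'' : nat -> btree,
     nleaves (t' k) @[k --> \oo] --> \oo ->
     nleaves (t'' k) @[k --> \oo] --> \oo ->
     martin_cvg X t' -> martin_cvg X t'' ->
     ((exists2 y, martin_boundary X y &
         martin_cvg_to X t' y /\ martin_cvg_to X t'' y) <->
      forall m, (0 < m)%N ->
        exists2 mu : probability btree R,
          sampled_cvg_to m t' mu & sampled_cvg_to m t'' mu)).
Proof.
split=> [t t_oo|t' t'' t'_oo t''_oo [y' _ ty'] [y'' _ ty'']]; split.
- move=> [y _ ty] m m0; have [mu] := martin_limit_sampled t_oo ty m0.
  by move/(_ t ty); exists mu.
- move=> H.
  have c s : (1 < leaf_count s)%N -> cvg (frequency R s (t k) @[k --> \oo]).
    move=> s1; have sm : leaf_count s = (leaf_count s).-1.+1 by lia.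
    have [|mu /sampled_frequency/(_ sm) tmu] := H (leaf_count s).-1; first by lia.
    by apply/cvg_ex; eexists; exact: tmu.
  (* The factor [martin_const] undoes the division in [limit_frequency]. *)
  pose y (s : tree3) : R := martin_const R (leaf_count (val s)) *
    lim (frequency R (val s) (t k) @[k --> \oo]).
  have ty : martin_cvg_to X t y.
    apply/martin_cvg_toP => s s1; have [u us] := nonleaf_tree3 s1.
    rewrite -us limit_frequencyE /y mulrC mulKf ?gt_eqF ?martin_const_gt0 //.
    by rewrite us; exact: c.
  by exists y => //; exact: martin_cvg_to_closure ty.
- move=> [y _ [ty1 ty2]] m m0; have [mu H] := martin_limit_sampled t'_oo ty1 m0.
  by exists mu; exact: H.
- move=> H; exists y'.
    split; first exact: martin_cvg_to_closure ty'.
    exact: martin_limit_not_state ty'.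
  (* The common law [mu] gives both sequences the same limiting frequency of [s], which for [t'] is
     the one read off [y']. *)
  split => //; apply/martin_cvg_toP => s s1.
  have sm : leaf_count s = (leaf_count s).-1.+1 by lia.
  have [|mu] := H (leaf_count s).-1; first by lia.
  move=> /sampled_frequency/(_ sm) c1 /sampled_frequency/(_ sm) c2.
  move/martin_cvg_toP: ty' => /(_ s s1) c3.
  by rewrite (cvg_unique _ c3 c1).
Qed.
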